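(* For each positive integer $n$ let $P_n$ be the $n$-path (vertices $1,\dots,n$, with an edge between $i$ and $i+1$ for $i=1,\dots,n-1$), and let $T_n$ be the geometric pebbling threshold of $P_n$. Then, as $n\to\infty$, $$T_n= e\,\frac{2^{\sqrt{\log_2 n}}}{\sqrt{\log_2 n}}\, n\left(1+O\!\left(\frac{1}{(\log n)^{1/4}}\right)\right).$$
   Context: Pebbling: a distribution on a graph assigns a nonnegative integer number of pebbles to each vertex. A pebbling move removes two pebbles from a vertex having at least two pebbles and adds one pebble to an adjacent vertex. A vertex is pebblable if some sequence of pebbling moves from the distribution ends with at least one pebble on it; a distribution is solvable if every vertex is pebblable. The geometric distribution on $\{0,1,2,\dots\}$ with parameter $0<p\le 1$ assigns probability $p(1-p)^k$ to $k$. For a graph $H$ with $n>0$ vertices, the geometric pebbling threshold of $H$ is the unique positive real $x$ such that, if an independent geometrically distributed number of pebbles with parameter $(1+x/n)^{-1}$ is placed on each vertex of $H$, the probability that the distribution is solvable equals $\tfrac12$. $\log$ is the natural logarithm. *)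

(* Defs.v *)
From Stdlib Require Import Reals Lra Lia List Relations.
Open Scope R_scope.

(* The n-path P_n: vertices 0,...,n-1 (relabelling of 1,...,n), edges {i,i+1}. *)
Definition path_adj (n u v : nat) : Prop :=
  (u < n)%nat /\ (v < n)%nat /\ (v = S u \/ u = S v).

(* A distribution on P_n: a function nat -> nat (only values on 0..n-1 matter). *)
Definition pebble_step (n : nat) (d d' : nat -> nat) : Prop :=
  exists u v, path_adj n u v /\ (2 <= d u)%nat /\
    d' u = (d u - 2)%nat /\ d' v = S (d v) /\
    (forall w, w <> u -> w <> v -> d' w = d w).

Definition pebble_reach (n : nat) : relation (nat -> nat) :=
  clos_refl_trans _ (pebble_step n).

Definition pebblable (n : nat) (d : nat -> nat) (v : nat) : Prop :=
  exists d', pebble_reach n d d' /\ (1 <= d' v)%nat.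

Definition solvable (n : nat) (d : nat -> nat) : Prop :=
  forall v, (v < n)%nat -> pebblable n d v.

Definition dist_of (l : list nat) : nat -> nat := fun i => nth i l 0%nat.

(* Probability of the configuration l under i.i.d. Geometric(p) pebble counts. *)
Definition geom_weight (p : R) (l : list nat) : R :=
  fold_right (fun k acc => p * (1 - p) ^ k * acc) 1 l.

Definition solv_partial_sums (n : nat) (p : R) : R -> Prop :=
  fun s => exists ls : list (list nat),
    NoDup ls /\
    Forall (fun l => length l = n /\ solvable n (dist_of l)) ls /\
    s = fold_right (fun l acc => geom_weight p l + acc) 0 ls.

(* P(solvable) = L : the (countable, nonnegative) sum equals L. *)
Definition solv_prob (n : nat) (p L : R) : Prop :=
  is_lub (solv_partial_sums n p) L.

Definition is_geom_threshold (n : nat) (x : R) : Prop :=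
  0 < x /\ solv_prob n (/ (1 + x / INR n)) (1 / 2) /\
  (forall y, 0 < y -> solv_prob n (/ (1 + y / INR n)) (1 / 2) -> y = x).

Definition log2 (x : R) : R := ln x / ln 2.

Definition main_term (n : nat) : R :=
  exp 1 * Rpower 2 (sqrt (log2 (INR n))) / sqrt (log2 (INR n)) * INR n.

(* Main.v *)
(* Write [lam = x / n] for the mean number of pebbles per vertex and [s = sqrt (log2 n)]. A vertex [v] is unpebblable exactly when it is empty and, on each side, the pebbles at distances [i] satisfy [sum d_i / 2^i < 1]. The probability [f] of one such side event is about the volume of a simplex, [lam^-k 2^(k(k+1)/2) / k!], with [k] close to [s]. A union bound over the vertices shows that unsolvable configurations are unlikely when [n f^2 / lam] is small; cutting the path into independent blocks shows that they are likely when it is large. Changing [lam] by a factor [1 + eta] changes [ln (n f^2 / lam)] by about [2 s eta], so estimating this logarithm to within [O (sqrt s)] locates the threshold up to a factor [1 + O (1 / sqrt s)], and [sqrt s] is of order [(ln n)^(1/4)]. *)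
Require Import Defs.
From Stdlib Require Import Reals Lra Lia Psatz List Relations Permutation Arith ZArith.
From Stdlib Require Import Classical ClassicalEpsilon.
Import ListNotations.
Open Scope R_scope.

(** * Pebbling one vertex of a path *)

(** With [ln n = s^2 ln 2] and [ln lam = s ln 2 - ln s + 1 + delta], the exponent [ln (n f^2 / lam)]
    is [(s - k) (s - k - 1) ln 2 - (2 k + 1) delta] up to lower-order terms. The summand [1], which
    becomes the factor [e] of the theorem, cancels the [e] in Stirling's [k! ~ (k / e)^k], and
    [- ln s] cancels [ln k]. The two bounds want opposite signs of the quadratic term:
    [k <= s < k + 1] makes it nonpositive, [k + 1 <= s] nonnegative. The losses around the simplex
    volume are really [exp (O (ln s ^ 2))]; estimating them by [exp (O (sqrt s))] is enough for the
    claimed error and keeps the inequalities elementary. The obstacle to independence is that a side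
    event involves the whole path. Each block therefore carries a slightly stronger local event,
    which forces side weight below 1 whatever stands outside the block, as long as every entry is
    below a cutoff [K]. For fixed [n] only finitely many configurations are unsolvable, so their
    probability is a polynomial in [p] and no infinite sum has to be handled beyond one
    reduction. *)

(* [l] lists the pebbles on one side of a vertex, nearest first: the entry at distance [i] weighs [1 / 2^i]. *)
Fixpoint wt (l : list nat) : R :=
  match l with
  | nil => 0
  | x :: l' => (INR x + wt l') / 2
  end.

(** Unsolvability read off the list: an empty vertex with two light sides. Both [a] and [b] run
    outwards from that vertex, hence the [rev]. *)
Definition bad (l : list nat) : Prop :=
  exists a b, l = rev a ++ O :: b /\ wt a < 1 /\ wt b < 1.

(* A path of vertices [g 0, g 1, ...] is read towards a target; [g] is either the identity or the reflection of the path. *)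
Definition reading (n : nat) (g : nat -> nat) : Prop :=
  (forall i, (i < n)%nat -> (g i < n)%nat /\ g (g i) = i) /\
  (forall i, (S i < n)%nat -> path_adj n (g i) (g (S i))) /\
  (forall u v, path_adj n u v -> path_adj n (g u) (g v)).

Fixpoint side_wt (g : nat -> nat) (d : nat -> nat) (j : nat) : R :=
  match j with
  | O => 0
  | S j' => (INR (d (g j')) + side_wt g d j') / 2
  end.

(* Number of pebbles on [g j] after moving greedily along [g 0, ..., g j]; the division rounds down. *)
Fixpoint flow (g : nat -> nat) (d : nat -> nat) (j : nat) : nat :=
  match j with
  | O => d (g 0%nat)
  | S j' => (d (g j) + flow g d j' / 2)%nat
  end.

Definition mirror (n i : nat) : nat := (n - 1 - i)%nat.

Lemma reading_id (n : nat) : reading n (fun i => i).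
Proof.
  split; [|split]; intros; auto.
  unfold path_adj; lia.
Qed.

Lemma reading_mirror (n : nat) : reading n (mirror n).
Proof.
  unfold mirror; split; [|split]; intros; unfold path_adj in *; lia.
Qed.

Lemma reading_inj (n : nat) (g : nat -> nat) (i j : nat) :
  reading n g -> (i < n)%nat -> (j < n)%nat -> g i = g j -> i = j.
Proof.
  intros [Hg _] Hi Hj E.
  destruct (Hg i Hi) as [_ Ei]; destruct (Hg j Hj) as [_ Ej].
  congruence.
Qed.

Lemma pebble_move_many (n u v m : nat) (d : nat -> nat) :
  path_adj n u v -> (2 * m <= d u)%nat ->
  exists d', pebble_reach n d d' /\ d' v = (d v + m)%nat /\
    (forall w, w <> u -> w <> v -> d' w = d w).
Proof.
  intros Huv; assert (u <> v) by (unfold path_adj in Huv; lia).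
  revert d; induction m as [|m IH]; intros d Hd.
  - exists d; split; [apply rt_refl|split; [lia|auto]].
  - set (e := fun w => if Nat.eq_dec w u then (d u - 2)%nat
                       else if Nat.eq_dec w v then S (d v) else d w).
    assert (Eu : e u = (d u - 2)%nat) by (unfold e; destruct (Nat.eq_dec u u); congruence).
    assert (Ev : e v = S (d v)).
    { unfold e; destruct (Nat.eq_dec v u); [congruence|].
      destruct (Nat.eq_dec v v); congruence. }
    assert (Ew : forall w, w <> u -> w <> v -> e w = d w).
    { intros w H1 H2; unfold e; destruct (Nat.eq_dec w u); [congruence|].
      destruct (Nat.eq_dec w v); congruence. }
    destruct (IH e) as (d' & R & V & W); [lia|].
    exists d'; split; [|split].
    + eapply rt_trans; [apply rt_step|exact R].
      exists u, v; split; [exact Huv|repeat split; auto; lia].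
    + lia.
    + intros w H1 H2; rewrite W, Ew; auto.
Qed.

(** The last clause is what drives the induction: the vertices ahead still hold their original
    pebbles when the walk arrives. *)
Lemma reach_flow (n : nat) (g d : nat -> nat) (j : nat) :
  reading n g -> (j < n)%nat ->
  exists d', pebble_reach n d d' /\ d' (g j) = flow g d j /\
    (forall i, (j < i < n)%nat -> d' (g i) = d (g i)).
Proof.
  intros Hg; induction j as [|j IH]; intros Hj.
  - exists d; split; [apply rt_refl|split; auto].
  - destruct IH as (d1 & R1 & V1 & W1); [lia|].
    destruct (pebble_move_many n (g j) (g (S j)) (flow g d j / 2) d1) as (d2 & R2 & V2 & W2).
    + apply (proj1 (proj2 Hg)); lia.
    + rewrite V1; pose proof (Nat.div_mod_eq (flow g d j) 2); lia.
    + exists d2; split; [eapply rt_trans; eauto|split].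
      * rewrite V2, (W1 (S j)) by lia; reflexivity.
      * intros i Hi; rewrite W2; [apply W1; lia| |];
          intros E; apply (reading_inj n g) in E; auto; lia.
Qed.

(** Rounding never costs a whole pebble. With [q] the rounded half of the flow [f],
    [x < (f + 1) / 2] and [f <= 2 q + 1] give [x < q + 1]; adding the new pebbles and halving
    restores the form of the bound. *)
Lemma side_wt_lt_flow (g d : nat -> nat) (j : nat) :
  side_wt g d (S j) < (INR (flow g d j) + 1) / 2.
Proof.
  induction j as [|j IH]; [simpl; lra|].
  change (side_wt g d (S (S j))) with ((INR (d (g (S j))) + side_wt g d (S j)) / 2).
  change (flow g d (S j)) with (d (g (S j)) + flow g d j / 2)%nat.
  rewrite plus_INR.
  assert (INR (flow g d j) <= 2 * INR (flow g d j / 2) + 1); [|lra].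
  replace 2 with (INR 2) by reflexivity; rewrite <- mult_INR, <- S_INR.
  apply le_INR; pose proof (Nat.div_mod_eq (flow g d j) 2).
  pose proof (Nat.mod_upper_bound (flow g d j) 2); lia.
Qed.

(** If the greedy walk brings nothing to [g j], its predecessor ends with at most one pebble, and
    the rounding bound with flow at most 1 gives weight below 1. *)
Lemma unpebblable_side_wt (n : nat) (g d : nat -> nat) (j : nat) :
  reading n g -> (j < n)%nat -> ~ pebblable n d (g j) ->
  d (g j) = 0%nat /\ side_wt g d j < 1.
Proof.
  intros Hg Hj Hnp.
  destruct (reach_flow n g d j Hg Hj) as (d' & R & V & _).
  assert (F : flow g d j = 0%nat).
  { destruct (Nat.eq_dec (flow g d j) 0) as [|E]; auto.
    exfalso; apply Hnp; exists d'; split; auto; lia. }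
  destruct j as [|j]; cbn [flow] in F; [split; [auto|simpl; lra]|].
  split; [lia|].
  pose proof (side_wt_lt_flow g d j).
  assert (flow g d j <= 1)%nat.
  { pose proof (Nat.div_mod_eq (flow g d j) 2).
    pose proof (Nat.mod_upper_bound (flow g d j) 2); lia. }
  assert (INR (flow g d j) <= 1) by (change 1 with (INR 1); apply le_INR; auto).
  lra.
Qed.

(* Weight of a pebble on [g i] in [side_wt g d j]. *)
Definition coef (j i : nat) : R := if lt_dec i j then (1 / 2) ^ (j - i) else 0.

Lemma coef_S (j i : nat) :
  coef (S j) i = (coef j i + (if Nat.eq_dec i j then 1 else 0)) / 2.
Proof.
  unfold coef; destruct (lt_dec i (S j)), (lt_dec i j), (Nat.eq_dec i j); try lia.
  - replace (S j - i)%nat with (S (j - i)) by lia; simpl; lra.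
  - replace (S j - i)%nat with 1%nat by lia; simpl; lra.
  - lra.
Qed.

(** A move from [a] to [b] trades two pebbles of coefficient [coef j a] for one of coefficient
    [coef j b], so moves avoiding the target do not raise a side weight. Since neither vertex is
    [j], such a move stays on one side. *)
Lemma coef_adj (j a b : nat) :
  (b = S a \/ a = S b) -> a <> j -> b <> j -> coef j b <= 2 * coef j a.
Proof.
  intros H Ha Hb; unfold coef; destruct (lt_dec b j), (lt_dec a j); try lia; try lra.
  destruct H; subst.
  - replace (j - a)%nat with (S (j - S a)) by lia; simpl; lra.
  - replace (j - b)%nat with (S (j - S b)) by lia; simpl.
    assert (0 <= (1 / 2) ^ (j - S b)) by (apply pow_le; lra); lra.
Qed.

Lemma side_wt_step (n : nat) (g d d' : nat -> nat) (a b j : nat) :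
  reading n g -> (a < n)%nat -> (b < n)%nat -> g a <> g b -> (2 <= d (g a))%nat ->
  d' (g a) = (d (g a) - 2)%nat -> d' (g b) = S (d (g b)) ->
  (forall w, w <> g a -> w <> g b -> d' w = d w) -> (j <= n)%nat ->
  side_wt g d' j = side_wt g d j - 2 * coef j a + coef j b.
Proof.
  intros Hg Ha Hb Hab Hd Da Db Dw; induction j as [|j IH]; intros Hj.
  - simpl; unfold coef; destruct (lt_dec a 0), (lt_dec b 0); try lia; lra.
  - simpl; rewrite IH by lia; rewrite !coef_S.
    assert (INR (d' (g j)) = INR (d (g j)) - 2 * (if Nat.eq_dec a j then 1 else 0)
              + (if Nat.eq_dec b j then 1 else 0)); [|lra].
    destruct (Nat.eq_dec a j), (Nat.eq_dec b j); subst; try congruence.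
    + rewrite Da, minus_INR by lia; simpl; lra.
    + rewrite Db, S_INR; lra.
    + rewrite Dw; [lra| |]; intros E; apply (reading_inj n g) in E; auto; lia.
Qed.

Lemma side_wt_ge (g d : nat -> nat) (i j : nat) :
  coef j i * INR (d (g i)) <= side_wt g d j.
Proof.
  induction j as [|j IH].
  - simpl; unfold coef; destruct (lt_dec i 0); [lia|lra].
  - rewrite coef_S; simpl.
    destruct (Nat.eq_dec i j); subst; pose proof (pos_INR (d (g j))); lra.
Qed.

Lemma side_wt_step_lt (n : nat) (g d d' : nat -> nat) (j u v : nat) :
  reading n g -> (j < n)%nat -> path_adj n u v -> (2 <= d u)%nat ->
  d' u = (d u - 2)%nat -> d' v = S (d v) ->
  (forall w, w <> u -> w <> v -> d' w = d w) ->
  u <> g j -> v <> g j -> side_wt g d j < 1 -> side_wt g d' j < 1.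
Proof.
  intros Hg Hj Huv Hd Du Dv Dw Nu Nv H.
  destruct Hg as (G1 & G2 & G3).
  destruct (G3 u v Huv) as (Lu & Lv & A).
  destruct Huv as (Hu & Hv & Huv).
  destruct (G1 u Hu) as [_ Eu]; destruct (G1 v Hv) as [_ Ev].
  rewrite (side_wt_step n g d d' (g u) (g v) j); rewrite ?Eu, ?Ev; auto; try lia.
  - assert (coef j (g v) <= 2 * coef j (g u)); [|lra].
    apply coef_adj; auto; intros E; [apply Nu|apply Nv]; rewrite <- E; auto.
  - split; auto.
Qed.

(** The invariant is that [v] is empty and both side weights are below 1. Other moves preserve it by
    [coef_adj], and a move onto [v] would need two pebbles on a neighbour, which alone weigh 1. *)
Lemma not_pebblable_of_side_wt (n : nat) (d : nat -> nat) (v : nat) :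
  (v < n)%nat -> d v = 0%nat -> side_wt (fun i => i) d v < 1 ->
  side_wt (mirror n) d (n - 1 - v) < 1 -> ~ pebblable n d v.
Proof.
  intros Hv H0 HL HR (e & R & He).
  assert (e v = 0%nat /\ side_wt (fun i => i) e v < 1 /\
          side_wt (mirror n) e (n - 1 - v) < 1) as [E _]; [|lia].
  clear He; apply clos_rt_rt1n in R.
  induction R as [d|d d' e' (a & b & Hab & Ha & Da & Db & Dw) _ IH]; auto.
  assert (a <> v) by (intros ->; lia).
  assert (b <> v).
  { intros ->; destruct Hab as (La & _ & [E|E]); subst.
    - pose proof (side_wt_ge (fun i => i) d a (S a)) as G; cbv beta in G.
      unfold coef in G; destruct (lt_dec a (S a)); [|lia].
      replace (S a - a)%nat with 1%nat in G by lia.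
      apply le_INR in Ha; simpl in *; lra.
    - pose proof (side_wt_ge (mirror n) d (n - 1 - S v) (n - 1 - v)) as G.
      replace (mirror n (n - 1 - S v)) with (S v) in G by (unfold mirror; lia).
      unfold coef in G; destruct (lt_dec (n - 1 - S v) (n - 1 - v)); [|lia].
      replace (n - 1 - v - (n - 1 - S v))%nat with 1%nat in G by lia.
      apply le_INR in Ha; simpl in *; lra. }
  apply IH.
  - rewrite Dw; auto.
  - eapply (side_wt_step_lt n (fun i => i) d d' v a b); eauto using reading_id.
  - assert (mirror n (n - 1 - v) = v) by (unfold mirror; lia).
    eapply (side_wt_step_lt n (mirror n) d d' (n - 1 - v) a b); eauto using reading_mirror;
      try lia; congruence.
Qed.

Lemma side_wt_left (l : list nat) (v : nat) :
  (v <= length l)%nat -> side_wt (fun i => i) (dist_of l) v = wt (rev (firstn v l)).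
Proof.
  induction v as [|v IH]; intros Hv; [reflexivity|].
  simpl side_wt; rewrite IH by lia.
  assert (E : firstn (S v) l = firstn v l ++ [nth v l 0%nat]).
  { clear IH; revert l Hv; induction v; intros [|x l] Hv; simpl in *; try lia; auto.
    rewrite <- IHv by lia; auto. }
  rewrite E, rev_app_distr; reflexivity.
Qed.

Lemma skipn_nth (l : list nat) (v : nat) :
  (v < length l)%nat -> skipn v l = nth v l 0%nat :: skipn (S v) l.
Proof.
  revert l; induction v as [|v IH]; intros [|x l] Hv; simpl in *; try lia; auto.
  rewrite IH by lia; reflexivity.
Qed.

Lemma side_wt_right (l : list nat) (j : nat) :
  (j <= length l)%nat ->
  side_wt (mirror (length l)) (dist_of l) j = wt (skipn (length l - j) l).
Proof.
  induction j as [|j IH]; intros Hj.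
  - rewrite Nat.sub_0_r, skipn_all; reflexivity.
  - simpl side_wt; rewrite IH by lia.
    rewrite (skipn_nth l (length l - S j)) by lia.
    replace (S (length l - S j)) with (length l - j)%nat by lia.
    simpl; unfold dist_of, mirror.
    replace (length l - 1 - j)%nat with (length l - S j)%nat by lia; reflexivity.
Qed.

Lemma bad_iff_nth (l : list nat) :
  bad l <-> exists v, (v < length l)%nat /\ nth v l 0%nat = O /\ wt (rev (firstn v l)) < 1 /\ wt (skipn (S v) l) < 1.
Proof.
  split.
  - intros (a & b & -> & Ha & Hb); exists (length a).
    rewrite length_app, length_rev; simpl length.
    split; [lia|split; [|split]].
    + rewrite app_nth2; rewrite length_rev; [|lia].
      rewrite Nat.sub_diag; reflexivity.
    + rewrite <- (length_rev a), firstn_app, Nat.sub_diag, firstn_all.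
      simpl; rewrite app_nil_r, rev_involutive; auto.
    + replace (rev a ++ O :: b) with ((rev a ++ [O]) ++ b)
        by (rewrite <- app_assoc; reflexivity).
      replace (S (length a)) with (length (rev a ++ [O]))
        by (rewrite length_app, length_rev; simpl; lia).
      rewrite skipn_app, skipn_all, Nat.sub_diag; auto.
  - intros (v & Hv & H0 & Ha & Hb).
    exists (rev (firstn v l)), (skipn (S v) l); repeat split; auto.
    rewrite rev_involutive, <- H0, <- skipn_nth by auto.
    symmetry; apply firstn_skipn.
Qed.

Lemma unsolvable_iff_bad (n : nat) (l : list nat) :
  length l = n -> (~ solvable n (dist_of l) <-> bad l).
Proof.
  intros Hn; rewrite bad_iff_nth; split.
  - intros H; apply not_all_ex_not in H as [v H]; apply imply_to_and in H as [Hv H].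
    exists v; split; [lia|].
    destruct (unpebblable_side_wt n (fun i => i) (dist_of l) v) as [H0 HL];
      auto using reading_id.
    destruct (unpebblable_side_wt n (mirror n) (dist_of l) (n - 1 - v)) as [_ HR];
      [apply reading_mirror|lia| |].
    { replace (mirror n (n - 1 - v)) with v by (unfold mirror; lia); auto. }
    rewrite side_wt_left in HL by lia.
    rewrite <- Hn, side_wt_right in HR by lia.
    replace (length l - (length l - 1 - v))%nat with (S v) in HR by lia; auto.
  - intros (v & Hv & H0 & HL & HR) S; apply (not_pebblable_of_side_wt n (dist_of l) v);
      [lia|exact H0| | |apply S; lia].
    + rewrite side_wt_left by lia; auto.
    + rewrite <- Hn, side_wt_right by lia.
      replace (length l - (length l - 1 - v))%nat with (Datatypes.S v) by lia; auto.
Qed.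

(** * Sums over truncated configurations *)

Definition lsum {A : Type} (f : A -> R) (l : list A) : R :=
  fold_right (fun x acc => f x + acc) 0 l.

Lemma lsum_app {A} (f : A -> R) (l1 l2 : list A) :
  lsum f (l1 ++ l2) = lsum f l1 + lsum f l2.
Proof. induction l1; simpl; [lra|]. rewrite IHl1; lra. Qed.

Lemma lsum_map {A B} (f : B -> R) (g : A -> B) (l : list A) :
  lsum f (map g l) = lsum (fun x => f (g x)) l.
Proof. induction l; simpl; [|rewrite IHl]; lra. Qed.

Lemma lsum_flat_map {A B} (f : B -> R) (g : A -> list B) (l : list A) :
  lsum f (flat_map g l) = lsum (fun x => lsum f (g x)) l.
Proof. induction l; simpl; [lra|]. rewrite lsum_app, IHl; lra. Qed.

Lemma lsum_le {A} (f g : A -> R) (l : list A) :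
  (forall x, In x l -> f x <= g x) -> lsum f l <= lsum g l.
Proof.
  induction l; simpl; intros H; [lra|].
  apply Rplus_le_compat; auto.
Qed.

Lemma lsum_ext {A} (f g : A -> R) (l : list A) :
  (forall x, In x l -> f x = g x) -> lsum f l = lsum g l.
Proof.
  intros H; apply Rle_antisym; apply lsum_le; intros x Hx; rewrite H; auto; lra.
Qed.

Lemma lsum_plus {A} (f g : A -> R) (l : list A) :
  lsum (fun x => f x + g x) l = lsum f l + lsum g l.
Proof. induction l; simpl; [|rewrite IHl]; lra. Qed.

Lemma lsum_scal {A} (c : R) (f : A -> R) (l : list A) :
  lsum (fun x => c * f x) l = c * lsum f l.
Proof. induction l; simpl; [|rewrite IHl]; lra. Qed.

Lemma lsum_nonneg {A} (f : A -> R) (l : list A) :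
  (forall x, In x l -> 0 <= f x) -> 0 <= lsum f l.
Proof.
  induction l; simpl; intros H; [lra|].
  pose proof (H a (or_introl eq_refl)); pose proof (IHl (fun x Hx => H x (or_intror Hx))); lra.
Qed.

Lemma lsum_le_const {A} (f : A -> R) (c : R) (l : list A) :
  (forall x, In x l -> f x <= c) -> lsum f l <= INR (length l) * c.
Proof.
  induction l; intros H; [simpl; lra|].
  cbn [length]; rewrite S_INR; simpl lsum.
  pose proof (H a (or_introl eq_refl)); pose proof (IHl (fun x Hx => H x (or_intror Hx))); lra.
Qed.

Lemma lsum_ge_const {A} (f : A -> R) (c : R) (l : list A) :
  (forall x, In x l -> c <= f x) -> INR (length l) * c <= lsum f l.
Proof.
  induction l; intros H; [simpl; lra|].
  cbn [length]; rewrite S_INR; simpl lsum.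
  pose proof (H a (or_introl eq_refl)); pose proof (IHl (fun x Hx => H x (or_intror Hx))); lra.
Qed.

Lemma lsum_exchange {A B} (f : A -> B -> R) (l1 : list A) (l2 : list B) :
  lsum (fun x => lsum (f x) l2) l1 = lsum (fun y => lsum (fun x => f x y) l1) l2.
Proof.
  induction l1; simpl.
  - induction l2; simpl; lra.
  - rewrite IHl1, <- lsum_plus; reflexivity.
Qed.

Lemma lsum_perm {A} (f : A -> R) (l1 l2 : list A) :
  Permutation l1 l2 -> lsum f l1 = lsum f l2.
Proof. induction 1; simpl; lra. Qed.

Lemma lsum_incl {A} (f : A -> R) (l1 l2 : list A) :
  (forall x, 0 <= f x) -> NoDup l1 -> incl l1 l2 -> lsum f l1 <= lsum f l2.
Proof.
  intros Hf Hn; revert l2; induction Hn as [|x l1 Hx Hn IH]; intros l2 Hi.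
  - apply lsum_nonneg; auto.
  - destruct (in_split x l2) as (a & b & ->); [apply Hi; left; auto|].
    rewrite (lsum_perm f (a ++ x :: b) (x :: a ++ b))
      by (symmetry; apply Permutation_middle).
    simpl; apply Rplus_le_compat_l, IH; intros y Hy.
    assert (In y (a ++ x :: b)) as Hy' by (apply Hi; right; auto).
    apply in_app_or in Hy' as [|[->|]]; apply in_or_app; auto; contradiction.
Qed.

Definition indic (P : Prop) : R := if excluded_middle_informative P then 1 else 0.

Lemma indic_true (P : Prop) : P -> indic P = 1.
Proof. unfold indic; destruct (excluded_middle_informative P); tauto. Qed.

Lemma indic_false (P : Prop) : ~ P -> indic P = 0.
Proof. unfold indic; destruct (excluded_middle_informative P); tauto. Qed.

Lemma indic_bounds (P : Prop) : 0 <= indic P <= 1.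
Proof. unfold indic; destruct (excluded_middle_informative P); lra. Qed.

Lemma indic_le (P : Prop) (x : R) : 0 <= x -> (P -> 1 <= x) -> indic P <= x.
Proof. unfold indic; destruct (excluded_middle_informative P); auto. Qed.

Lemma indic_mono (P Q : Prop) : (P -> Q) -> indic P <= indic Q.
Proof.
  intros H; apply indic_le; [apply indic_bounds|].
  intros HP; rewrite (indic_true Q); auto; lra.
Qed.

Fixpoint box (K n : nat) : list (list nat) :=
  match n with
  | O => [nil]
  | S n' => flat_map (fun k => map (cons k) (box K n')) (seq 0 K)
  end.

(** A truncated expectation that is not renormalised: its total mass falls short of 1 by at most
    [n (1 - p)^K]. *)
Definition expect (K : nat) (p : R) (n : nat) (h : list nat -> R) : R :=
  lsum (fun l => geom_weight p l * h l) (box K n).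

Lemma in_box (K n : nat) (l : list nat) :
  In l (box K n) <-> length l = n /\ Forall (fun x => (x < K)%nat) l.
Proof.
  revert l; induction n as [|n IH]; intros l; simpl.
  - split; [intros [<-|[]]; auto|].
    intros [H _]; left; symmetry; apply length_zero_iff_nil; auto.
  - rewrite in_flat_map; split.
    + intros (k & Hk & Hl); apply in_map_iff in Hl as (l' & <- & Hl').
      apply IH in Hl' as [L F]; apply in_seq in Hk; simpl; split; [lia|].
      constructor; auto; lia.
    + intros [L F]; destruct l as [|k l]; simpl in L; [lia|].
      inversion F; subst; exists k; split; [apply in_seq; lia|].
      apply in_map, IH; split; auto; lia.
Qed.

Lemma NoDup_box (K n : nat) : NoDup (box K n).
Proof.
  induction n as [|n IH]; simpl; [repeat constructor; auto|].
  generalize (seq_NoDup K 0); induction (seq 0 K) as [|k ks IHk]; intros H; simpl; [constructor|].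
  inversion H as [|? ? Hk Hks]; subst; apply NoDup_app.
  - apply FinFun.Injective_map_NoDup; auto; intros x y; congruence.
  - auto.
  - intros l H1 H2; apply in_map_iff in H1 as (l1 & <- & _).
    apply in_flat_map in H2 as (k' & Hk' & H2).
    apply in_map_iff in H2 as (l2 & E & _); inversion E; subst; auto.
Qed.

Lemma geom_weight_pos (p : R) (l : list nat) : 0 < p < 1 -> 0 < geom_weight p l.
Proof.
  intros Hp; induction l as [|k l IH]; simpl; [lra|].
  apply Rmult_lt_0_compat; auto; apply Rmult_lt_0_compat; [lra|apply pow_lt; lra].
Qed.

Lemma geom_weight_app (p : R) (l1 l2 : list nat) :
  geom_weight p (l1 ++ l2) = geom_weight p l1 * geom_weight p l2.
Proof. induction l1; simpl; [|rewrite IHl1]; lra. Qed.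

Lemma geom_weight_rev (p : R) (l : list nat) : geom_weight p (rev l) = geom_weight p l.
Proof. induction l; simpl; auto; rewrite geom_weight_app, IHl; simpl; ring. Qed.

Lemma expect_0 (K : nat) (p : R) (h : list nat -> R) : expect K p 0 h = h nil.
Proof. unfold expect; simpl; lra. Qed.

Lemma expect_S (K : nat) (p : R) (n : nat) (h : list nat -> R) :
  expect K p (S n) h = lsum (fun k => p * (1 - p) ^ k * expect K p n (fun l => h (k :: l))) (seq 0 K).
Proof.
  unfold expect; simpl box; rewrite lsum_flat_map; apply lsum_ext; intros k _.
  rewrite lsum_map, <- lsum_scal; apply lsum_ext; intros l _; simpl; ring.
Qed.

Lemma expect_le (K : nat) (p : R) (n : nat) (h1 h2 : list nat -> R) :
  0 < p < 1 ->
  (forall l, length l = n -> Forall (fun x => (x < K)%nat) l -> h1 l <= h2 l) ->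
  expect K p n h1 <= expect K p n h2.
Proof.
  intros Hp H; apply lsum_le; intros l Hl; apply in_box in Hl as [L F].
  apply Rmult_le_compat_l; auto; left; apply geom_weight_pos; auto.
Qed.

Lemma expect_ext (K : nat) (p : R) (n : nat) (h1 h2 : list nat -> R) :
  (forall l, length l = n -> Forall (fun x => (x < K)%nat) l -> h1 l = h2 l) ->
  expect K p n h1 = expect K p n h2.
Proof.
  intros H; apply lsum_ext; intros l Hl; apply in_box in Hl as [L F]; rewrite H; auto.
Qed.

Lemma expect_plus (K : nat) (p : R) (n : nat) (h1 h2 : list nat -> R) :
  expect K p n (fun l => h1 l + h2 l) = expect K p n h1 + expect K p n h2.
Proof.
  unfold expect; rewrite <- lsum_plus; apply lsum_ext; intros; ring.
Qed.

Lemma expect_scal (K : nat) (p : R) (n : nat) (c : R) (h : list nat -> R) :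
  expect K p n (fun l => c * h l) = c * expect K p n h.
Proof.
  unfold expect; rewrite <- lsum_scal; apply lsum_ext; intros; ring.
Qed.

Lemma expect_minus (K : nat) (p : R) (n : nat) (h1 h2 : list nat -> R) :
  expect K p n (fun l => h1 l - h2 l) = expect K p n h1 - expect K p n h2.
Proof.
  rewrite <- (Rmult_1_l (expect K p n h2)).
  replace (expect K p n h1 - 1 * expect K p n h2) with (expect K p n h1 + (-1) * expect K p n h2) by ring.
  rewrite <- expect_scal, <- expect_plus; apply expect_ext; intros; ring.
Qed.

Lemma expect_lsum {A} (K : nat) (p : R) (n : nat) (h : A -> list nat -> R) (r : list A) :
  expect K p n (fun l => lsum (fun v => h v l) r) = lsum (fun v => expect K p n (h v)) r.
Proof.
  unfold expect; rewrite <- lsum_exchange; apply lsum_ext; intros; rewrite lsum_scal; reflexivity.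
Qed.

Lemma expect_nonneg (K : nat) (p : R) (n : nat) (h : list nat -> R) :
  0 < p < 1 ->
  (forall l, length l = n -> Forall (fun x => (x < K)%nat) l -> 0 <= h l) ->
  0 <= expect K p n h.
Proof.
  intros Hp H; replace 0 with (expect K p n (fun _ => 0)); [apply expect_le; auto|].
  unfold expect; rewrite (lsum_ext _ (fun l => 0 * geom_weight p l)), lsum_scal; intros; ring.
Qed.

(** Independence of disjoint segments of the path, in the only form used later. *)
Lemma expect_app (K : nat) (p : R) (n1 n2 : nat) (h1 h2 : list nat -> R) :
  expect K p (n1 + n2) (fun l => h1 (firstn n1 l) * h2 (skipn n1 l)) =
  expect K p n1 h1 * expect K p n2 h2.
Proof.
  revert h1; induction n1 as [|n1 IH]; intros h1.
  - rewrite expect_0; exact (expect_scal K p n2 (h1 nil) h2).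
  - simpl plus; rewrite !expect_S, Rmult_comm, <- lsum_scal; apply lsum_ext; intros k _.
    cbn [firstn skipn]; rewrite (IH (fun l => h1 (k :: l))); ring.
Qed.

Lemma expect_rev (K : nat) (p : R) (n : nat) (h : list nat -> R) :
  expect K p n (fun l => h (rev l)) = expect K p n h.
Proof.
  unfold expect.
  rewrite (lsum_ext _ (fun l => geom_weight p (rev l) * h (rev l)))
    by (intros; rewrite geom_weight_rev; auto).
  rewrite <- (lsum_map (fun l => geom_weight p l * h l) (@rev nat)).
  apply lsum_perm, NoDup_Permutation.
  - apply FinFun.Injective_map_NoDup; [|apply NoDup_box].
    intros x y E; rewrite <- (rev_involutive x), E; apply rev_involutive.
  - apply NoDup_box.
  - intros l; rewrite in_map_iff; split.
    + intros (l' & <- & H); apply in_box in H as [L F]; apply in_box.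
      rewrite length_rev; split; auto; apply Forall_rev; auto.
    + intros H; apply in_box in H as [L F]; exists (rev l); rewrite rev_involutive.
      split; auto; apply in_box; rewrite length_rev; split; auto; apply Forall_rev; auto.
Qed.

Lemma geom_head_sum (p : R) (K : nat) :
  lsum (fun k => p * (1 - p) ^ k) (seq 0 K) = 1 - (1 - p) ^ K.
Proof.
  induction K as [|K IH]; [simpl; lra|].
  rewrite seq_S, lsum_app, IH; simpl; ring.
Qed.

Lemma expect_one (K : nat) (p : R) (n : nat) : expect K p n (fun _ => 1) = (1 - (1 - p) ^ K) ^ n.
Proof.
  induction n as [|n IH]; [apply expect_0|].
  rewrite expect_S, IH, <- tech_pow_Rmult.
  set (c := (1 - (1 - p) ^ K) ^ n); rewrite <- geom_head_sum, Rmult_comm, <- lsum_scal.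
  apply lsum_ext; intros; ring.
Qed.

Lemma head_mass_bounds (p : R) (K : nat) : 0 < p < 1 -> 0 <= 1 - (1 - p) ^ K <= 1.
Proof.
  intros Hp; assert (0 <= (1 - p) ^ K) by (apply pow_le; lra).
  pose proof (pow_incr (1 - p) 1 K ltac:(lra)) as H1; rewrite pow1 in H1; lra.
Qed.

Lemma expect_one_le (K : nat) (p : R) (n : nat) : 0 < p < 1 -> expect K p n (fun _ => 1) <= 1.
Proof.
  intros Hp; rewrite expect_one.
  pose proof (pow_incr _ 1 n (head_mass_bounds p K Hp)) as H; rewrite pow1 in H; auto.
Qed.

Lemma expect_le_1 (K : nat) (p : R) (n : nat) (h : list nat -> R) :
  0 < p < 1 -> (forall l, h l <= 1) -> expect K p n h <= 1.
Proof.
  intros Hp H; eapply Rle_trans; [|apply (expect_one_le K p n Hp)]; apply expect_le; auto.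
Qed.

Lemma expect_one_ge (K : nat) (p : R) (n : nat) :
  0 < p < 1 -> 1 - INR n * (1 - p) ^ K <= expect K p n (fun _ => 1).
Proof.
  intros Hp; rewrite expect_one.
  pose proof (head_mass_bounds p K Hp); set (y := (1 - p) ^ K) in *.
  induction n as [|n IH]; [simpl; lra|].
  rewrite S_INR; simpl.
  apply Rle_trans with ((1 - y) * (1 - INR n * y)).
  - pose proof (pos_INR n); assert (0 <= INR n * (y * y)) by (apply Rmult_le_pos; nra); lra.
  - apply Rmult_le_compat_l; lra.
Qed.

(** Tests whether position [a] is an unpebblable vertex, once [h1] and [h2] are indicators of light
    sides; the left part is reversed so that both tests see the nearest entry first. *)
Definition center (a : nat) (h1 h2 : list nat -> R) (l : list nat) : R :=
  h1 (rev (firstn a l)) * (indic (nth a l O = O) * h2 (skipn (S a) l)).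

Lemma expect_center (K : nat) (p : R) (a b : nat) (h1 h2 : list nat -> R) :
  (0 < K)%nat ->
  expect K p (a + S b) (center a h1 h2) = expect K p a h1 * (p * expect K p b h2).
Proof.
  intros HK.
  set (h3 := fun l => indic (nth 0 l O = O) * h2 (skipn 1 l)).
  set (h1' := fun l => h1 (rev l)).
  rewrite (expect_ext K p _ _ (fun l => h1' (firstn a l) * h3 (skipn a l))).
  - rewrite expect_app; unfold h1'; rewrite expect_rev; f_equal.
    rewrite expect_S; destruct K as [|K]; [lia|].
    simpl seq; simpl lsum; unfold h3; simpl.
    rewrite (expect_ext _ _ _ _ h2) by (intros; rewrite indic_true; auto; ring).
    rewrite (lsum_ext _ (fun _ => 0 * 0)), lsum_scal; [ring|].
    intros k Hk; apply in_seq in Hk.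
    rewrite (expect_ext _ _ _ _ (fun _ => 0 * 0)).
    + rewrite expect_scal; ring.
    + intros; rewrite indic_false by lia; ring.
  - intros l L _; unfold center, h3; f_equal; f_equal.
    + rewrite nth_skipn, Nat.add_0_r; reflexivity.
    + rewrite skipn_skipn; reflexivity.
Qed.

(** * The probability of an unsolvable configuration *)

Lemma wt_nonneg (l : list nat) : 0 <= wt l.
Proof. induction l as [|x l IH]; simpl; [lra|]; pose proof (pos_INR x); lra. Qed.

Lemma wt_app (a b : list nat) : wt (a ++ b) = wt a + (1 / 2) ^ length a * wt b.
Proof. induction a as [|x a IH]; simpl; [|rewrite IH]; lra. Qed.

Lemma wt_entry (l : list nat) (x : nat) : In x l -> INR x <= 2 ^ length l * wt l.
Proof.
  induction l as [|y l IH]; simpl; [tauto|].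
  assert (H2 : 1 <= 2 ^ length l) by (apply pow_R1_Rle; lra).
  pose proof (wt_nonneg l); pose proof (pos_INR y).
  intros [->|Hx].
  - assert (0 <= (2 ^ length l - 1) * INR x) by (apply Rmult_le_pos; lra).
    assert (0 <= 2 ^ length l * wt l) by (apply Rmult_le_pos; lra); lra.
  - assert (0 <= 2 ^ length l * INR y) by (apply Rmult_le_pos; lra).
    specialize (IH Hx); lra.
Qed.

Lemma small_entries (l : list nat) (n : nat) :
  wt l < 1 -> (length l <= n)%nat -> Forall (fun x => (x < 2 ^ n)%nat) l.
Proof.
  intros Hw Hl; apply Forall_forall; intros x Hx.
  apply INR_lt; rewrite pow_INR; change (INR 2) with 2.
  pose proof (wt_entry l x Hx).
  assert (2 ^ length l <= 2 ^ n) by (apply Rle_pow; lra || auto).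
  assert (0 < 2 ^ length l) by (apply pow_lt; lra).
  assert (2 ^ length l * wt l < 2 ^ length l * 1) by (apply Rmult_lt_compat_l; auto); lra.
Qed.

Lemma bad_entries (l : list nat) : bad l -> Forall (fun x => (x < 2 ^ length l)%nat) l.
Proof.
  intros (a & b & -> & Ha & Hb).
  assert (L : length (rev a ++ O :: b) = (length a + S (length b))%nat)
    by (rewrite length_app, length_rev; reflexivity).
  apply Forall_app; split; [apply Forall_rev|constructor].
  - apply small_entries; auto; lia.
  - pose proof (Nat.pow_nonzero 2 (length (rev a ++ O :: b))); lia.
  - apply small_entries; auto; lia.
Qed.

Lemma wt_le (l l' : list nat) : Forall2 le l l' -> wt l <= wt l'.
Proof.
  induction 1 as [|x y l l' Hxy H IH]; simpl; [lra|]; apply le_INR in Hxy; lra.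
Qed.

Lemma Forall2_rev {A B} (R : A -> B -> Prop) (l : list A) (l' : list B) :
  Forall2 R l l' -> Forall2 R (rev l) (rev l').
Proof.
  induction 1; simpl; auto; apply Forall2_app; auto.
Qed.

Lemma bad_downset (l l' : list nat) : Forall2 le l l' -> bad l' -> bad l.
Proof.
  intros H (a & b & -> & Ha & Hb).
  apply Forall2_app_inv_r in H as (l1 & l2 & H1 & H2 & ->).
  inversion H2 as [|x y l3 l4 Hx H3]; subst.
  exists (rev l1), l3; repeat split.
  - rewrite rev_involutive; f_equal; f_equal; lia.
  - apply Forall2_rev in H1; rewrite rev_involutive in H1.
    apply wt_le in H1; lra.
  - apply wt_le in H3; lra.
Qed.

(* The cutoff is harmless because [bad] forces every entry below [2 ^ n]. *)
Definition unsolv_prob (n : nat) (p : R) : R := expect (2 ^ n) p n (fun l => indic (bad l)).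

Lemma lsum_filter {A} (P : A -> Prop) (f : A -> R) (l : list A) :
  lsum f (filter (fun x => if excluded_middle_informative (P x) then true else false) l) =
  lsum (fun x => f x * indic (P x)) l.
Proof.
  unfold indic; induction l; simpl; auto.
  destruct (excluded_middle_informative (P a)); simpl; rewrite IHl; lra.
Qed.

Lemma expect_sub (K K' n : nat) (p : R) (P : list nat -> Prop) :
  0 < p < 1 -> (forall l, length l = n -> Forall (fun x => (x < K)%nat) l -> P l ->
    Forall (fun x => (x < K')%nat) l) ->
  expect K p n (fun l => indic (P l)) <= expect K' p n (fun l => indic (P l)).
Proof.
  intros Hp H; unfold expect; rewrite <- !lsum_filter; apply lsum_incl.
  - intros; left; apply geom_weight_pos; auto.
  - apply NoDup_filter, NoDup_box.
  - intros l Hl; apply filter_In in Hl as [Hl1 Hl2]; apply filter_In; split; auto.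
    apply in_box in Hl1 as [L F]; apply in_box; split; auto; apply H; auto.
    destruct (excluded_middle_informative (P l)); [auto|discriminate].
Qed.

Lemma expect_bad_le (K n : nat) (p : R) :
  0 < p < 1 -> expect K p n (fun l => indic (bad l)) <= unsolv_prob n p.
Proof.
  intros Hp; apply expect_sub; auto; intros l <- _; apply bad_entries.
Qed.

Lemma expect_bad_eq (K n : nat) (p : R) :
  0 < p < 1 -> (2 ^ n <= K)%nat -> expect K p n (fun l => indic (bad l)) = unsolv_prob n p.
Proof.
  intros Hp HK; apply Rle_antisym; [apply expect_bad_le; auto|].
  apply expect_sub; auto; intros l <- F _; eapply Forall_impl; [|exact F]; intros; simpl in *; lia.
Qed.

Lemma entries_bounded (ls : list (list nat)) :
  exists K, Forall (fun l => Forall (fun x => (x < K)%nat) l) ls.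
Proof.
  assert (H1 : forall l, exists K, Forall (fun x => (x < K)%nat) l).
  { induction l as [|x l [K HK]]; [exists O; auto|].
    exists (S x + K)%nat; constructor; [lia|].
    eapply Forall_impl; [|exact HK]; intros; simpl in *; lia. }
  induction ls as [|l ls [K HK]]; [exists O; auto|].
  destruct (H1 l) as [K' HK'].
  exists (K + K')%nat; constructor.
  - eapply Forall_impl; [|exact HK']; intros; simpl in *; lia.
  - eapply Forall_impl; [|exact HK]; intros l' Hl'.
    eapply Forall_impl; [|exact Hl']; intros; simpl in *; lia.
Qed.

Lemma expect_good (K n : nat) (p : R) :
  0 < p < 1 -> (2 ^ n <= K)%nat ->
  lsum (geom_weight p) (filter (fun l => if excluded_middle_informative (~ bad l)
    then true else false) (box K n)) = expect K p n (fun _ => 1) - unsolv_prob n p.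
Proof.
  intros Hp HK; rewrite lsum_filter, <- (expect_bad_eq K) by auto.
  rewrite <- expect_minus; unfold expect; apply lsum_ext; intros l _; f_equal.
  destruct (classic (bad l)); [rewrite indic_false, indic_true|rewrite indic_true, indic_false]; tauto || lra.
Qed.

(** Every finite family of solvable configurations fits into a box, whose solvable part has mass at
    most [1 - unsolv_prob n p]; conversely, large boxes lose arbitrarily little mass. *)
Lemma solv_prob_unsolv_prob (n : nat) (p : R) :
  0 < p < 1 -> solv_prob n p (1 - unsolv_prob n p).
Proof.
  intros Hp; split.
  - intros x (ls & ND & F & ->).
    destruct (entries_bounded ls) as [K HK].
    rewrite Forall_forall in F, HK.
    apply Rle_trans with (expect (K + 2 ^ n) p n (fun _ => 1) - unsolv_prob n p);
      [|pose proof (expect_one_le (K + 2 ^ n) p n Hp); lra].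
    rewrite <- expect_good by (auto; lia); apply lsum_incl; auto.
    + intros; left; apply geom_weight_pos; auto.
    + intros l Hl; apply filter_In; split.
      * apply in_box; split; [apply F; auto|].
        eapply Forall_impl; [|apply (HK l Hl)]; intros; simpl in *; lia.
      * destruct (excluded_middle_informative (~ bad l)) as [|H]; auto.
        exfalso; apply H; rewrite <- (unsolvable_iff_bad n) by apply F, Hl.
        pose proof (proj2 (F l Hl)); tauto.
  - intros b Hb; apply Rnot_lt_le; intros Hlt.
    set (eps := 1 - unsolv_prob n p - b).
    assert (Hn : 0 < INR n + 1) by (pose proof (pos_INR n); lra).
    destruct (pow_lt_1_zero (1 - p)) with (y := eps / (INR n + 1)) as [N HN].
    { rewrite Rabs_pos_eq; lra. }
    { apply Rdiv_lt_0_compat; unfold eps; lra. }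
    (* The cutoff must exceed [N], to lose less than [eps], and reach [2 ^ n], to contain all
       unsolvable configurations. *)
    specialize (HN (N + 2 ^ n)%nat ltac:(lia)).
    set (K := (N + 2 ^ n)%nat) in *.
    assert (H0 : 0 <= (1 - p) ^ K) by (apply pow_le; lra).
    rewrite Rabs_pos_eq in HN by auto.
    assert (H : expect K p n (fun _ => 1) - unsolv_prob n p <= b).
    { apply Hb; rewrite <- expect_good by (auto; unfold K; lia).
      eexists; split; [apply NoDup_filter, NoDup_box|split; [|reflexivity]].
      apply Forall_forall; intros l Hl; apply filter_In in Hl as [H1 H2].
      apply in_box in H1 as [L _]; split; auto.
      destruct (excluded_middle_informative (~ bad l)) as [H|]; [|discriminate].
      rewrite <- (unsolvable_iff_bad n) in H by auto; apply NNPP, H. }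
    pose proof (expect_one_ge K p n Hp).
    assert ((INR n + 1) * (1 - p) ^ K < eps); [|unfold eps in *; lra].
    apply (Rmult_lt_compat_l (INR n + 1)) in HN; auto.
    replace ((INR n + 1) * (eps / (INR n + 1))) with eps in HN by (field; lra); auto.
Qed.

Lemma solv_prob_iff (n : nat) (p L : R) :
  0 < p < 1 -> (solv_prob n p L <-> L = 1 - unsolv_prob n p).
Proof.
  intros Hp; pose proof (solv_prob_unsolv_prob n p Hp) as H; split.
  - intros H'; apply (is_lub_u (solv_partial_sums n p)); auto.
  - intros ->; auto.
Qed.

(** * Monotonicity and continuity in the parameter *)

Lemma expect_pos (K n : nat) (p : R) (h : list nat -> R) :
  0 < p < 1 -> (0 < K)%nat -> (forall l, 0 <= h l) -> 0 < h (repeat O n) -> 0 < expect K p n h.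
Proof.
  intros Hp HK; revert h; induction n as [|n IH]; intros h H0 H1; [rewrite expect_0; auto|].
  rewrite expect_S; destruct K as [|K]; [lia|]; simpl seq; simpl lsum.
  apply Rplus_lt_le_0_compat.
  - assert (0 < expect (S K) p n (fun l => h (O :: l))) by (apply (IH (fun l => h (O :: l))); auto).
    simpl; apply Rmult_lt_0_compat; lra.
  - apply lsum_nonneg; intros k _; apply Rmult_le_pos.
    + apply Rmult_le_pos; [lra|apply pow_le; lra].
    + apply expect_nonneg; auto.
Qed.

Definition geom_mean (K : nat) (p : R) (e : nat -> R) : R :=
  lsum (fun k => p * (1 - p) ^ k * e k) (seq 0 K).

(** Memorylessness: a geometric variable is 0 with probability [p] and otherwise 1 plus a fresh
    copy. *)
Lemma geom_mean_S (K : nat) (p : R) (e : nat -> R) :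
  geom_mean (S K) p e = p * e O + (1 - p) * geom_mean K p (fun k => e (S k)).
Proof.
  unfold geom_mean; rewrite <- lsum_scal; simpl; rewrite <- seq_shift, lsum_map.
  rewrite Rmult_1_r; f_equal; apply lsum_ext; intros; simpl; ring.
Qed.

Lemma geom_mean_le_head (K : nat) (p : R) (e : nat -> R) :
  0 < p < 1 -> (forall k, e (S k) <= e k) -> (forall k, 0 <= e k) ->
  geom_mean K p e <= e O.
Proof.
  intros Hp; revert e; induction K as [|K IH]; intros e He H0; [apply H0|].
  rewrite geom_mean_S.
  specialize (IH (fun k => e (S k)) (fun k => He (S k)) (fun k => H0 (S k))).
  pose proof (He O); simpl in *; nra.
Qed.

Lemma geom_mean_lt_head (K : nat) (p : R) (e : nat -> R) :
  0 < p < 1 -> (forall k, e (S k) <= e k) -> (forall k, 0 <= e k) -> 0 < e O ->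
  geom_mean K p e < e O.
Proof.
  intros Hp; revert e; induction K as [|K IH]; intros e He H0 H1; [apply H1|].
  rewrite geom_mean_S.
  assert (geom_mean K p (fun k => e (S k)) < e O); [|nra].
  destruct (Rlt_dec 0 (e 1%nat)).
  - specialize (IH (fun k => e (S k)) (fun k => He (S k)) (fun k => H0 (S k))).
    pose proof (He O); simpl in *; lra.
  - pose proof (geom_mean_le_head K p (fun k => e (S k)) Hp
      (fun k => He (S k)) (fun k => H0 (S k))); simpl in *; lra.
Qed.

(** This replaces a coupling: in [p * e 0 + (1 - p) * m] the mean [m] of the shifted sequence is at
    most [e 0], so raising [p] moves weight to the larger value. *)
Lemma geom_mean_mono (K : nat) (p p' : R) (e : nat -> R) :
  0 < p <= p' -> p' < 1 -> (forall k, e (S k) <= e k) -> (forall k, 0 <= e k) ->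
  geom_mean K p e <= geom_mean K p' e.
Proof.
  intros Hp Hp'; revert e; induction K as [|K IH]; intros e He H0; [apply Rle_refl|].
  rewrite !geom_mean_S.
  specialize (IH (fun k => e (S k)) (fun k => He (S k)) (fun k => H0 (S k))).
  pose proof (geom_mean_le_head K p' (fun k => e (S k)) ltac:(lra)
    (fun k => He (S k)) (fun k => H0 (S k))); pose proof (He O); simpl in *; nra.
Qed.

Lemma geom_mean_strict (K : nat) (p p' : R) (e : nat -> R) :
  0 < p < p' -> p' < 1 -> (0 < K)%nat -> (forall k, e (S k) <= e k) -> (forall k, 0 <= e k) ->
  0 < e O -> geom_mean K p e < geom_mean K p' e.
Proof.
  intros Hp Hp' HK He H0 H1; destruct K as [|K]; [lia|].
  rewrite !geom_mean_S.
  pose proof (geom_mean_mono K p p' (fun k => e (S k)) ltac:(lra) Hp'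
    (fun k => He (S k)) (fun k => H0 (S k))).
  assert (geom_mean K p' (fun k => e (S k)) < e O); [|nra].
  destruct (Rlt_dec 0 (e 1%nat)).
  - pose proof (geom_mean_lt_head K p' (fun k => e (S k)) ltac:(lra)
      (fun k => He (S k)) (fun k => H0 (S k))); pose proof (He O); simpl in *; lra.
  - pose proof (geom_mean_le_head K p' (fun k => e (S k)) ltac:(lra)
      (fun k => He (S k)) (fun k => H0 (S k))); simpl in *; lra.
Qed.

Definition antitone (h : list nat -> R) : Prop :=
  forall l l', Forall2 le l l' -> h l' <= h l.

Lemma Forall2_le_refl (l : list nat) : Forall2 le l l.
Proof. induction l; auto. Qed.

Lemma antitone_cons (h : list nat -> R) (k : nat) :
  antitone h -> antitone (fun l => h (k :: l)).
Proof. intros H l l' Hl; apply H; auto. Qed.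

Lemma expect_cons_decr (K n : nat) (p : R) (h : list nat -> R) (k : nat) :
  0 < p < 1 -> antitone h ->
  expect K p n (fun l => h (S k :: l)) <= expect K p n (fun l => h (k :: l)).
Proof.
  intros Hp H; apply expect_le; auto; intros; apply H; constructor; auto using Forall2_le_refl.
Qed.

Lemma expect_mono (K n : nat) (p p' : R) (h : list nat -> R) :
  0 < p <= p' -> p' < 1 -> antitone h -> (forall l, 0 <= h l) ->
  expect K p n h <= expect K p' n h.
Proof.
  intros Hp Hp'; revert h; induction n as [|n IH]; intros h Ha H0; [rewrite !expect_0; lra|].
  (* A hybrid of the two sides: the tail already has parameter [p'], the first entry still has
     [p]. *)
  rewrite !expect_S; apply Rle_trans with (geom_mean K p (fun k => expect K p' n (fun l => h (k :: l)))).
  - apply lsum_le; intros k _; apply Rmult_le_compat_l.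
    + apply Rmult_le_pos; [lra|apply pow_le; lra].
    + apply (IH (fun l => h (k :: l))); auto using antitone_cons.
  - apply geom_mean_mono; auto.
    + intros k; apply expect_cons_decr; auto; lra.
    + intros k; apply expect_nonneg; auto; lra.
Qed.

Lemma expect_strict (K n : nat) (p p' : R) (h : list nat -> R) :
  0 < p < p' -> p' < 1 -> (0 < K)%nat -> (0 < n)%nat -> antitone h ->
  (forall l, 0 <= h l) -> 0 < h (repeat O n) ->
  expect K p n h < expect K p' n h.
Proof.
  intros Hp Hp' HK Hn Ha H0 H1; destruct n as [|n]; [lia|].
  rewrite !expect_S.
  apply Rle_lt_trans with (geom_mean K p (fun k => expect K p' n (fun l => h (k :: l)))).
  - apply lsum_le; intros k _; apply Rmult_le_compat_l.
    + apply Rmult_le_pos; [lra|apply pow_le; lra].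
    + apply (expect_mono K n p p' (fun l => h (k :: l))); auto using antitone_cons; lra.
  - apply geom_mean_strict; auto.
    + intros k; apply expect_cons_decr; auto; lra.
    + intros k; apply expect_nonneg; auto; lra.
    + apply expect_pos; auto; lra.
Qed.

Lemma wt_repeat_0 (n : nat) : wt (repeat O n) = 0.
Proof. induction n; simpl; [|rewrite IHn]; lra. Qed.

Lemma unsolv_prob_strict (n : nat) (p p' : R) :
  (0 < n)%nat -> 0 < p < p' -> p' < 1 -> unsolv_prob n p < unsolv_prob n p'.
Proof.
  intros Hn Hp Hp'; apply expect_strict; auto.
  - pose proof (Nat.pow_nonzero 2 n); lia.
  - intros l l' H; apply indic_mono, bad_downset; auto.
  - intros; apply indic_bounds.
  - rewrite indic_true; [lra|].
    destruct n as [|n]; [lia|].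
    exists [], (repeat O n); rewrite wt_repeat_0; simpl; repeat split; lra.
Qed.

(** Thanks to the cutoff this is a finite sum of polynomials in [p]. *)
Lemma unsolv_prob_continuous (n : nat) : continuity (unsolv_prob n).
Proof.
  unfold unsolv_prob, expect; induction (box (2 ^ n) n) as [|l ls IH]; simpl.
  - apply continuity_const; intros x y; reflexivity.
  - apply (continuity_plus (fun p => geom_weight p l * indic (bad l))
      (fun p => lsum (fun l => geom_weight p l * indic (bad l)) ls)); auto.
    apply (continuity_mult (fun p => geom_weight p l) (fun _ => indic (bad l)));
      [|apply continuity_const; intros x y; reflexivity].
    clear; induction l as [|k l IH]; simpl.
    + apply continuity_const; intros x y; reflexivity.
    + apply (continuity_mult (fun p => p * (1 - p) ^ k) (fun p => geom_weight p l)); auto.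
      apply (continuity_mult (fun p => p) (fun p => (1 - p) ^ k)).
      * apply derivable_continuous, derivable_id.
      * apply derivable_continuous; reg.
Qed.

Lemma prob_param_bounds (lam : R) : 0 < lam -> 0 < / (1 + lam) < 1.
Proof.
  intros H; split; [apply Rinv_0_lt_compat; lra|].
  rewrite <- Rinv_1 at 2; apply Rinv_lt_contravar; lra.
Qed.

(* [lam1] and [lam2] are mean numbers of pebbles per vertex, hence the division by [n]. *)
Lemma threshold_bracket (n : nat) (lam1 lam2 : R) :
  (0 < n)%nat -> 0 < lam1 -> lam1 < lam2 ->
  1 / 2 < unsolv_prob n (/ (1 + lam1)) -> unsolv_prob n (/ (1 + lam2)) < 1 / 2 ->
  (exists T, is_geom_threshold n T) /\
  (forall T, is_geom_threshold n T -> lam1 < T / INR n < lam2).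
Proof.
  intros Hn H1 H12 P1 P2; pose proof (lt_0_INR n Hn) as Hn'.
  assert (B1 := prob_param_bounds lam1 H1).
  assert (B2 := prob_param_bounds lam2 ltac:(lra)).
  assert (Hlt : forall x y, 0 < x -> x < y -> / (1 + y) < / (1 + x)).
  { intros x y Hx Hy; apply Rinv_lt_contravar; [apply Rmult_lt_0_compat|]; lra. }
  assert (Hmono : forall x y, 0 < x -> x < y -> unsolv_prob n (/ (1 + y)) < unsolv_prob n (/ (1 + x))).
  { intros x y Hx Hy; apply unsolv_prob_strict; auto.
    - split; [apply prob_param_bounds; lra|auto].
    - apply prob_param_bounds; auto. }
  assert (Heq : forall x y, 0 < x -> 0 < y ->
    unsolv_prob n (/ (1 + x)) = unsolv_prob n (/ (1 + y)) -> x = y).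
  { intros x y Hx Hy E; destruct (Rtotal_order x y) as [H|[H|H]]; auto;
      apply Hmono in H; auto; lra. }
  assert (Hhalf : forall x, 0 < x ->
    (solv_prob n (/ (1 + x)) (1 / 2) <-> unsolv_prob n (/ (1 + x)) = 1 / 2)).
  { intros x Hx; rewrite solv_prob_iff by (apply prob_param_bounds; auto); lra. }
  assert (Hpos : forall x, 0 < x -> 0 < x / INR n) by (intros; apply Rdiv_lt_0_compat; auto).
  split.
  (* The intermediate value is sought in [p], which decreases in the mean, so the endpoints swap;
     the threshold is then [n (1 / p - 1)]. *)
  - destruct (IVT (fun p => unsolv_prob n p - 1 / 2) (/ (1 + lam2)) (/ (1 + lam1))) as (p & Hp & E).
    + apply (continuity_minus (unsolv_prob n) (fun _ => 1 / 2)); [apply unsolv_prob_continuous|].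
      apply continuity_const; intros x y; reflexivity.
    + apply Hlt; auto.
    + lra.
    + lra.
    + assert (0 < p < 1) by lra.
      assert (E1 : 1 + INR n * (/ p - 1) / INR n = / p) by (field; lra).
      assert (Hx : 0 < INR n * (/ p - 1)).
      { apply Rmult_lt_0_compat; auto; rewrite <- Rinv_1.
        assert (/ 1 < / p); [apply Rinv_lt_contravar|]; lra. }
      exists (INR n * (/ p - 1)); split; [auto|split].
      * apply Hhalf; auto; rewrite E1, Rinv_inv; lra.
      * intros y Hy Sy; apply Hhalf in Sy; auto.
        assert (y / INR n = INR n * (/ p - 1) / INR n) as E2.
        { apply Heq; auto; rewrite E1, Rinv_inv, Sy; lra. }
        apply (Rmult_eq_reg_r (/ INR n)); [exact E2|apply Rinv_neq_0_compat; lra].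
  - intros T (HT & S & _); apply Hhalf in S; auto.
    pose proof (Hpos T HT) as HT'.
    split; apply Rnot_le_lt; intros H; apply Rle_lt_or_eq_dec in H as [H|H].
    + apply Hmono in H; auto; lra.
    + rewrite <- H in P1; lra.
    + apply Hmono in H; lra.
    + rewrite H in P2; lra.
Qed.

(** * Union bound *)

Definition side_prob (K : nat) (p : R) (j : nat) : R := expect K p j (fun l => indic (wt l < 1)).

Lemma side_prob_bounds (K : nat) (p : R) (j : nat) : 0 < p < 1 -> 0 <= side_prob K p j <= 1.
Proof.
  intros Hp; split; [apply expect_nonneg|apply expect_le_1]; auto; intros; apply indic_bounds.
Qed.

Lemma unsolv_prob_le_sum (n : nat) (p : R) :
  0 < p < 1 ->
  unsolv_prob n p <= lsum (fun v => p * (side_prob (2 ^ n) p v * side_prob (2 ^ n) p (n - 1 - v))) (seq 0 n).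
Proof.
  intros Hp; assert (HK : (0 < 2 ^ n)%nat) by (pose proof (Nat.pow_nonzero 2 n); lia).
  set (h := fun l => indic (wt l < 1)).
  apply Rle_trans with (expect (2 ^ n) p n (fun l => lsum (fun v => center v h h l) (seq 0 n))).
  - apply expect_le; auto; intros l L _; apply indic_le.
    + apply lsum_nonneg; intros v _; unfold center, h.
      repeat apply Rmult_le_pos; apply indic_bounds.
    + rewrite bad_iff_nth; intros (v & Hv & H0 & H1 & H2).
      apply Rle_trans with (lsum (fun v => center v h h l) [v]).
      * simpl; unfold center, h; rewrite !indic_true by auto; lra.
      * apply lsum_incl.
        -- intros u; unfold center, h; repeat apply Rmult_le_pos; apply indic_bounds.
        -- repeat constructor; auto.
        -- intros u [<-|[]]; apply in_seq; lia.
  - rewrite expect_lsum; apply lsum_le; intros v Hv; apply in_seq in Hv.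
    assert (Ev : expect (2 ^ n) p n (center v h h) = expect (2 ^ n) p (v + S (n - 1 - v)) (center v h h))
      by (f_equal; lia).
    change (fun l => center v h h l) with (center v h h); rewrite Ev, expect_center by auto; unfold side_prob, h; lra.
Qed.

Lemma side_prob_anti (K : nat) (p : R) (k j : nat) :
  0 < p < 1 -> (k <= j)%nat -> side_prob K p j <= side_prob K p k.
Proof.
  intros Hp Hkj; unfold side_prob; replace j with (k + (j - k))%nat by lia.
  set (h := fun l => indic (wt l < 1)); set (one := fun _ : list nat => 1).
  apply Rle_trans with (expect K p (k + (j - k)) (fun l => h (firstn k l) * one (skipn k l))).
  - apply expect_le; auto; intros l _ _; unfold h, one; rewrite Rmult_1_r; apply indic_mono.
    rewrite <- (firstn_skipn k l) at 1; rewrite wt_app.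
    assert (0 <= (1 / 2) ^ length (firstn k l) * wt (skipn k l)); [|lra].
    apply Rmult_le_pos; [apply pow_le; lra|apply wt_nonneg].
  - rewrite expect_app; pose proof (expect_one_le K p (j - k) Hp).
    pose proof (side_prob_bounds K p k Hp); unfold side_prob in *; unfold one; fold h in H0 |- *; nra.
Qed.

(* Only the [2 k] vertices within distance [k] of an end have a side shorter than [k]. *)
Lemma unsolv_prob_le_side (n k : nat) (p F : R) :
  0 < p < 1 -> (2 * k <= n)%nat -> side_prob (2 ^ n) p k <= F ->
  unsolv_prob n p <= p * (INR n * F ^ 2 + 2 * INR k * F).
Proof.
  intros Hp Hk HF; eapply Rle_trans; [apply unsolv_prob_le_sum; auto|].
  rewrite lsum_scal; apply Rmult_le_compat_l; [lra|].
  set (A := side_prob (2 ^ n) p) in *.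
  assert (B : forall j, 0 <= A j <= 1) by (intros; apply side_prob_bounds; auto).
  assert (D : forall j, (k <= j)%nat -> A j <= F).
  { intros; eapply Rle_trans; [apply side_prob_anti|]; eauto. }
  assert (F0 : 0 <= F) by (pose proof (B k); lra).
  assert (Es : seq 0 n = seq 0 (k + ((n - 2 * k) + k))) by (f_equal; lia).
  rewrite Es, !seq_app, !lsum_app.
  assert (E1 : lsum (fun v => A v * A (n - 1 - v)%nat) (seq 0 k) <= INR k * F).
  { eapply Rle_trans; [apply (lsum_le_const _ F)|rewrite length_seq; lra]; intros v Hv; apply in_seq in Hv.
    pose proof (D (n - 1 - v)%nat ltac:(lia)); pose proof (B v);
      pose proof (B (n - 1 - v)%nat); nra. }
  assert (E2 : lsum (fun v => A v * A (n - 1 - v)%nat) (seq (0 + k) (n - 2 * k)) <= INR n * F ^ 2).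
  { apply Rle_trans with (INR (length (seq (0 + k) (n - 2 * k))) * F ^ 2).
    - apply lsum_le_const; intros v Hv; apply in_seq in Hv.
      pose proof (D (n - 1 - v)%nat ltac:(lia)); pose proof (D v ltac:(lia)); pose proof (B v);
      pose proof (B (n - 1 - v)%nat); simpl; nra.
    - rewrite length_seq; apply Rmult_le_compat_r; [apply pow_le; auto|apply le_INR; lia]. }
  assert (E3 : lsum (fun v => A v * A (n - 1 - v)%nat) (seq (0 + k + (n - 2 * k)) k) <= INR k * F).
  { eapply Rle_trans; [apply (lsum_le_const _ F)|rewrite length_seq; lra].
    intros v Hv; apply in_seq in Hv.
    pose proof (D v ltac:(lia)); pose proof (B v);
      pose proof (B (n - 1 - v)%nat); nra. }
  lra.
Qed.

(** * Chernoff bound for one side *)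

Lemma exp_monotone (x y : R) : x <= y -> exp x <= exp y.
Proof. intros [H| ->]; [left; apply exp_increasing; auto|apply Rle_refl]. Qed.

Lemma ln_quot (x y : R) : 0 < x -> 0 < y -> ln (x / y) = ln x - ln y.
Proof.
  intros Hx Hy; unfold Rdiv; rewrite ln_mult, ln_Rinv; auto using Rinv_0_lt_compat; ring.
Qed.

(** Turns the product of the factors [1 + theta / 2^i] into the exponential of a convergent
    geometric series. *)
Lemma exp_lower_sqrt (y : R) : 0 <= y -> 1 + y <= exp (2 * sqrt y).
Proof.
  intros Hy; replace (2 * sqrt y) with (sqrt y + sqrt y) by ring; rewrite exp_plus.
  pose proof (exp_ineq1_le (sqrt y)); pose proof (sqrt_pos y).
  pose proof (sqrt_sqrt y Hy); nra.
Qed.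

(** The full series has sum [p / (1 - r)] with [r = (1 - p) exp (- y)], and
    [exp (- y) <= 1 / (1 + y)] gives [1 - r >= y / (1 + y)]. *)
Lemma geom_laplace_le (K : nat) (p y : R) :
  0 < p < 1 -> 0 < y ->
  lsum (fun k => p * (1 - p) ^ k * exp (- y * INR k)) (seq 0 K) <= p * (1 + y) / y.
Proof.
  intros Hp Hy.
  assert (G : forall r, 0 < r < 1 -> lsum (fun k => r ^ k) (seq 0 K) * (1 - r) <= 1).
  { intros r Hr.
    assert (lsum (fun k => r ^ k) (seq 0 K) * (1 - r) = 1 - r ^ K);
      [|pose proof (pow_lt r K ltac:(lra)); lra].
    induction K as [|K IH]; [simpl; lra|].
    rewrite seq_S, lsum_app, Rmult_plus_distr_r, IH; simpl; ring. }
  set (r := (1 - p) * exp (- y)).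
  assert (He : exp (- y) <= / (1 + y)).
  { rewrite exp_Ropp; apply Rinv_le_contravar; [lra|apply exp_ineq1_le]. }
  pose proof (exp_pos (- y)).
  assert (Hr : 0 < r < / (1 + y)).
  { unfold r; split; [apply Rmult_lt_0_compat; lra|nra]. }
  assert (H1 : y / (1 + y) <= 1 - r).
  { replace (y / (1 + y)) with (1 - / (1 + y)) by (field; lra); lra. }
  assert (H2 : / (1 + y) < 1).
  { rewrite <- Rinv_1 at 2; apply Rinv_lt_contravar; lra. }
  specialize (G r ltac:(lra)).
  rewrite (lsum_ext _ (fun k => p * r ^ k)), lsum_scal.
  - unfold Rdiv; rewrite Rmult_assoc; apply Rmult_le_compat_l; [lra|].
    set (S := lsum (fun k => r ^ k) (seq 0 K)) in *.
    assert (0 <= S) by (apply lsum_nonneg; intros; apply pow_le; lra).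
    assert (S * (y / (1 + y)) <= 1) by (apply Rle_trans with (S * (1 - r)); auto; nra).
    apply (Rmult_le_reg_r (y / (1 + y))); [apply Rdiv_lt_0_compat; lra|].
    replace ((1 + y) * / y * (y / (1 + y))) with 1 by (field; lra); auto.
  - intros k _; unfold r; rewrite Rpow_mult_distr.
    replace (exp (- y * INR k)) with (exp (- y) ^ k); [ring|].
    induction k as [|k IH]; [simpl; rewrite Rmult_0_r, exp_0; auto|].
    rewrite S_INR, Rmult_plus_distr_l, exp_plus, <- IH, Rmult_1_r; simpl; ring.
Qed.

(** Logarithm of the product of [p * 2^i / theta] over [1 <= i <= j], with [5 sqrt theta] absorbing
    the product of the [1 + theta / 2^i]. *)
Definition laplace_exponent (p theta : R) (j : nat) : R :=
  INR j * ln p + INR j * (INR j + 1) / 2 * ln 2 - INR j * ln theta + 5 * sqrt theta.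

Lemma laplace_wt (K : nat) (p theta : R) (j : nat) :
  0 < p < 1 -> 0 < theta ->
  expect K p j (fun l => exp (- theta * wt l)) <= exp (laplace_exponent p theta j).
Proof.
  intros Hp; revert theta; induction j as [|j IH]; intros theta Ht.
  - rewrite expect_0; simpl; left; apply exp_increasing; unfold laplace_exponent; simpl.
    pose proof (sqrt_lt_R0 theta Ht); lra.
  - rewrite expect_S; specialize (IH (theta / 2) ltac:(lra)).
    set (E := expect K p j (fun l => exp (- (theta / 2) * wt l))) in *.
    rewrite (lsum_ext _ (fun k => E * (p * (1 - p) ^ k * exp (- (theta / 2) * INR k)))).
    + rewrite lsum_scal.
      pose proof (geom_laplace_le K p (theta / 2) Hp ltac:(lra)) as G.
      set (S := lsum _ (seq 0 K)) in *.
      assert (0 <= S).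
      { apply lsum_nonneg; intros; apply Rmult_le_pos; [|left; apply exp_pos].
        apply Rmult_le_pos; [lra|apply pow_le; lra]. }
      apply Rle_trans with (exp (laplace_exponent p (theta / 2) j) * (p * (1 + theta / 2) / (theta / 2))).
      { apply Rmult_le_compat; auto; apply expect_nonneg; auto; intros; left; apply exp_pos. }
      apply Rle_trans with (exp (laplace_exponent p (theta / 2) j) *
        exp (ln p + 2 * sqrt (theta / 2) - ln (theta / 2))).
      { apply Rmult_le_compat_l; [left; apply exp_pos|].
        unfold Rminus; rewrite !exp_plus, exp_Ropp, !exp_ln by lra.
        unfold Rdiv at 1; apply Rmult_le_compat_r; [left; apply Rinv_0_lt_compat; lra|].
        apply Rmult_le_compat_l; [lra|apply exp_lower_sqrt; lra]. }
      rewrite <- exp_plus; apply exp_monotone; unfold laplace_exponent.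
      rewrite S_INR, ln_quot by lra.
      (* The constant 5 is fixed here: the new factor costs [2 sqrt (theta / 2)] on top of
         [5 sqrt (theta / 2)], and [49 / 2 <= 25]. *)
      assert (Hs : 7 * sqrt (theta / 2) <= 5 * sqrt theta).
      { apply Rsqr_incr_0_var; [|pose proof (sqrt_pos theta); lra].
        rewrite !Rsqr_mult, !Rsqr_sqrt by lra; unfold Rsqr; lra. }
      nra.
    + intros k _.
      rewrite (expect_ext _ _ _ _ (fun l => exp (- (theta / 2) * INR k) * exp (- (theta / 2) * wt l))).
      * rewrite expect_scal; unfold E; ring.
      * intros l _ _; rewrite <- exp_plus; f_equal; simpl; field.
Qed.

(* Chernoff bound with tilt [theta = k]; the tilt is near-optimal because the simplex is [k]-dimensional. *)
Lemma side_prob_le (K : nat) (p : R) (k : nat) :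
  0 < p < 1 -> (0 < k)%nat ->
  side_prob K p k <= exp (INR k + laplace_exponent p (INR k) k).
Proof.
  intros Hp Hk; assert (0 < INR k) by (apply lt_0_INR; auto).
  rewrite exp_plus; apply Rle_trans with (exp (INR k) * expect K p k (fun l => exp (- INR k * wt l))).
  - rewrite <- expect_scal; apply expect_le; auto; intros l _ _.
    rewrite <- exp_plus; apply indic_le; [left; apply exp_pos|].
    intros Hw; rewrite <- exp_0; apply exp_monotone; nra.
  - apply Rmult_le_compat_l; [left; apply exp_pos|apply laplace_wt; auto].
Qed.

Lemma ln_le_sqrt (x : R) : 0 < x -> ln x <= 2 * sqrt x - 2.
Proof.
  intros Hx; pose proof (sqrt_lt_R0 x Hx) as Hs.
  rewrite <- (sqrt_sqrt x) at 1 by lra; rewrite ln_mult by auto.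
  pose proof (exp_ineq1_le (ln (sqrt x))) as H; rewrite exp_ln in H by auto; lra.
Qed.

Lemma ln_le_minus_1 (x : R) : 0 < x -> ln x <= x - 1.
Proof.
  intros Hx; pose proof (exp_ineq1_le (ln x)) as H; rewrite exp_ln in H by auto; lra.
Qed.

Lemma nat_floor (x : R) : 0 <= x -> exists k : nat, INR k <= x < INR k + 1.
Proof.
  intros Hx; destruct (archimed x) as [H1 H2].
  assert (0 < up x)%Z by (apply lt_IZR; simpl; lra).
  exists (Z.to_nat (up x - 1)); rewrite INR_IZR_INZ, Z2Nat.id by lia.
  rewrite minus_IZR; simpl; lra.
Qed.

Lemma ln2_bounds : 1 / 2 < ln 2 < 1.
Proof.
  split.
  - exact ln_lt_2 || (pose proof ln_lt_2; lra).
  - rewrite <- (ln_exp 1); apply ln_increasing; [lra|].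
    pose proof (exp_ineq1 1); lra.
Qed.

(** Takes [k = floor s] in the union bound. Interior and end vertices each contribute at most
    1/8. *)
Lemma unsolv_prob_upper (n : nat) (lam s : R) :
  30 <= s -> (0 < n)%nat -> ln (INR n) = s * s * ln 2 -> 0 < lam ->
  s * ln 2 - ln s + 1 + 20 / sqrt s <= ln lam ->
  unsolv_prob n (/ (1 + lam)) < 1 / 2.
Proof.
  intros Hs Hn0 Hn Hlam Hl; pose proof ln2_bounds as L2.
  destruct (nat_floor s) as (k & Hk1 & Hk2); [lra|].
  pose proof (prob_param_bounds lam Hlam) as Hp; set (p := / (1 + lam)) in *.
  assert (HnR : 0 < INR n) by (apply lt_0_INR; auto).
  assert (Hk0 : (0 < k)%nat) by (apply INR_lt; simpl; lra).
  set (E := INR k + laplace_exponent p (INR k) k).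
  assert (Ep : ln p <= - ln lam).
  { unfold p; rewrite ln_Rinv by lra; apply Ropp_le_contravar; left; apply ln_increasing; lra. }
  assert (Hq := sqrt_lt_R0 s ltac:(lra)); assert (Hqq := sqrt_sqrt s ltac:(lra)).
  (* The bound [-7] is chosen because [exp 7 >= 8]. The margin [20 / sqrt s], multiplied by
     [2 k + 1 >= s], beats the [10 sqrt k] of the two Laplace bounds and the stray [ln s]. *)
  assert (HE : ln (INR n) + ln p + 2 * E <= - 7).
  { unfold E, laplace_exponent; rewrite Hn.
    assert (Hlns := ln_le_sqrt s ltac:(lra)).
    assert (Hks : INR k * (ln s - ln (INR k)) <= s - INR k).
    { rewrite <- ln_quot by lra.
      pose proof (ln_le_minus_1 (s / INR k) ltac:(apply Rdiv_lt_0_compat; lra)).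
      apply Rle_trans with (INR k * (s / INR k - 1)); [apply Rmult_le_compat_l; lra|].
      right; field; lra. }
    assert (Hsk : sqrt (INR k) <= sqrt s) by (apply sqrt_le_1; lra).
    assert (Hc : 20 * sqrt s <= (2 * INR k + 1) * (20 / sqrt s)).
    { apply Rle_trans with (s * (20 / sqrt s)).
      - right; rewrite <- Hqq at 2; field; lra.
      - apply Rmult_le_compat_r; [left; apply Rdiv_lt_0_compat|]; lra. }
    assert (Hm : (2 * INR k + 1) * ln p <=
      - ((2 * INR k + 1) * (s * ln 2 - ln s + 1 + 20 / sqrt s))) by nra.
    (* All terms quadratic in [s] and [k] combine to the negative of this product. *)
    assert (Ha : 0 <= (s - INR k) * (INR k + 1 - s) * ln 2).
    { apply Rmult_le_pos; [apply Rmult_le_pos|]; lra. }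
    assert (1 <= sqrt s) by nra.
    nra. }
  set (F := exp E).
  assert (HF : INR n * (p * F ^ 2) <= 1 / 8).
  { replace (INR n * (p * F ^ 2)) with (exp (ln (INR n) + ln p + 2 * E)).
    - apply Rle_trans with (exp (Ropp 7)); [apply exp_monotone; lra|].
      rewrite exp_Ropp; pose proof (exp_ineq1_le 7).
      apply Rle_trans with (/ 8); [apply Rinv_le_contravar|]; lra.
    - replace (2 * E) with (E + E) by ring.
      rewrite !exp_plus, !exp_ln by lra; unfold F; simpl; ring. }
  assert (Hbig : 900 * s * s <= INR n).
  { rewrite <- (exp_ln (INR n)), Hn by auto.
    apply Rle_trans with (exp (s * s / 2)); [|apply exp_monotone; nra].
    replace (s * s / 2) with (s * s / 8 + s * s / 8 + (s * s / 8 + s * s / 8)) by lra.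
    rewrite !exp_plus; pose proof (exp_ineq1_le (s * s / 8)).
    set (x := exp (s * s / 8)) in *.
    assert (100 <= x) by nra.
    assert (s * s / 8 * 100 <= x * x) by nra.
    assert (10000 <= x * x) by nra. nra. }
  assert (F0 : 0 < F) by apply exp_pos.
  (* Squaring reduces the end vertices to the interior bound: [(2 k p F)^2 <= 4 s^2 p F^2], and
     [n >= 900 s^2]. *)
  assert (HF2 : 2 * INR k * (p * F) <= 1 / 8).
  { apply Rsqr_incr_0_var; [|lra]; unfold Rsqr.
    assert (p * F ^ 2 * (900 * s * s) <= 1 / 8).
    { apply Rle_trans with (INR n * (p * F ^ 2)); auto; rewrite Rmult_comm.
      apply Rmult_le_compat_r; auto; apply Rmult_le_pos; [lra|apply pow_le; lra]. }
    assert (X : 2 * INR k * (p * F) * (2 * INR k * (p * F)) <= 4 * (s * s) * (p * F ^ 2)).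
    { replace (2 * INR k * (p * F) * (2 * INR k * (p * F)))
        with (4 * (INR k * INR k * p) * (p * F ^ 2)) by (simpl; ring).
      apply Rmult_le_compat_r; [apply Rmult_le_pos; [lra|apply pow_le; lra]|].
      apply Rmult_le_compat_l; [lra|].
      pose proof (Rmult_le_pos (INR k) (INR k)); nra. }
    nra. }
  assert (H2k : (2 * k <= n)%nat).
  { apply INR_le; rewrite mult_INR; simpl; nra. }
  pose proof (unsolv_prob_le_side n k p F Hp H2k (side_prob_le (2 ^ n) p k Hp Hk0)).
  lra.
Qed.

(** * Independent blocks *)

Lemma pow_diff_le (n : nat) (a b : R) :
  0 <= b <= a -> a ^ S n - b ^ S n <= (INR n + 1) * (a - b) * a ^ n.
Proof.
  intros H; induction n as [|n IH]; [simpl; lra|].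
  rewrite S_INR.
  assert (b ^ S n <= a ^ S n) by (apply pow_incr; auto).
  replace (a ^ S (S n) - b ^ S (S n))
    with (a * (a ^ S n - b ^ S n) + (a - b) * b ^ S n) by (simpl; ring).
  apply Rle_trans with (a * ((INR n + 1) * (a - b) * a ^ n) + (a - b) * a ^ S n).
  - apply Rplus_le_compat; apply Rmult_le_compat_l; lra.
  - right; simpl; ring.
Qed.

(** A sum of a decreasing function dominates the integral of [(T - x)^k] over [[0, T]]. The
    induction removes the term at 0 and uses [T^(k+1) - (T-1)^(k+1) <= (k+1) T^k]. *)
Lemma pow_sum_ge (K k : nat) (T : R) :
  0 <= T <= INR K ->
  T ^ S k / (INR k + 1) <=
  lsum (fun x => indic (INR x <= T) * (T - INR x) ^ k) (seq 0 K).
Proof.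
  assert (Hk : 0 < INR k + 1) by (pose proof (pos_INR k); lra).
  revert T; induction K as [|K IH]; intros T HT.
  - simpl in HT; replace T with 0 by lra; simpl; unfold Rdiv; lra.
  - rewrite S_INR in HT; simpl seq; simpl lsum; rewrite <- seq_shift, lsum_map.
    rewrite indic_true by (simpl; lra).
    replace (1 * (T - 0) ^ k) with (T ^ k) by (rewrite Rminus_0_r; ring).
    destruct (Rle_dec 1 T) as [H1|H1].
    + specialize (IH (T - 1) ltac:(lra)).
      rewrite (lsum_ext _ (fun x => indic (INR x <= T - 1) * (T - 1 - INR x) ^ k)).
      * pose proof (pow_diff_le k T (T - 1) ltac:(lra)) as D.
        assert ((T ^ S k - (T - 1) ^ S k) / (INR k + 1) <= T ^ k); [|unfold Rdiv in *; lra].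
        apply (Rmult_le_reg_r (INR k + 1)); auto; unfold Rdiv.
        rewrite Rmult_assoc, Rinv_l, Rmult_1_r by lra; lra.
      * intros x _; rewrite S_INR; f_equal; [|f_equal; ring].
        unfold indic; destruct (excluded_middle_informative _), (excluded_middle_informative _); lra.
    + assert (0 <= lsum (fun x => indic (INR (S x) <= T) * (T - INR (S x)) ^ k) (seq 0 K)).
      { apply lsum_nonneg; intros x _; unfold indic; destruct (excluded_middle_informative _); [|lra].
        apply Rmult_le_pos; [lra|apply pow_le; lra]. }
      assert (0 <= T ^ k) by (apply pow_le; lra).
      assert (T ^ S k / (INR k + 1) <= T ^ k); [|lra].
      apply (Rmult_le_reg_r (INR k + 1)); auto; unfold Rdiv.
      rewrite Rmult_assoc, Rinv_l, Rmult_1_r by lra.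
      pose proof (pos_INR k); simpl; nra.
Qed.

(* Volume of the simplex [{x >= 0 | sum_(i <= k) x_i / 2^i <= 1}]. *)
Fixpoint vol (k : nat) : R :=
  match k with
  | O => 1
  | S k' => 2 ^ S k' / INR (S k') * vol k'
  end.

Lemma vol_pos (k : nat) : 0 < vol k.
Proof.
  induction k; cbn [vol]; [lra|]; apply Rmult_lt_0_compat; auto.
  apply Rdiv_lt_0_compat; [apply pow_lt; lra|apply lt_0_INR; lia].
Qed.

(* The unit cubes based at the lattice points of the simplex cover it. *)
Lemma count_ge_vol (K k : nat) (t : R) :
  0 <= t -> 2 ^ k * t <= INR K ->
  t ^ k * vol k <= lsum (fun l => indic (wt l <= t)) (box K k).
Proof.
  revert t; induction k as [|k IH]; intros t Ht HK.
  - simpl; rewrite indic_true; lra.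
  - assert (P2 : 1 <= 2 ^ k) by (apply pow_R1_Rle; lra).
    simpl in HK; simpl box; rewrite lsum_flat_map.
    assert (0 < INR k + 1) by (pose proof (pos_INR k); lra).
    pose proof (vol_pos k) as V.
    apply Rle_trans with (vol k * lsum (fun x => indic (INR x <= 2 * t) * (2 * t - INR x) ^ k) (seq 0 K)).
    (* Slicing by the first entry [x] leaves weight at most [2 t - x] for the others; the integral
       of the slices is the recurrence of [vol]. *)
    + apply Rle_trans with (vol k * ((2 * t) ^ S k / (INR k + 1))).
      * right; cbn [vol]; rewrite S_INR, Rpow_mult_distr; field; lra.
      * apply Rmult_le_compat_l; [lra|apply pow_sum_ge; nra].
    + rewrite <- lsum_scal; apply lsum_le; intros x _; rewrite lsum_map.
      destruct (Rle_dec (INR x) (2 * t)) as [Hx|Hx].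
      * rewrite indic_true by auto; rewrite Rmult_1_l, Rmult_comm.
        pose proof (pos_INR x).
        eapply Rle_trans; [apply (IH (2 * t - INR x)); [lra|nra]|].
        apply lsum_le; intros l _; apply indic_mono; simpl; lra.
      * rewrite indic_false by auto; rewrite Rmult_0_l, Rmult_0_r.
        apply lsum_nonneg; intros; apply indic_bounds.
Qed.

Lemma list_sum_wt (l : list nat) : INR (list_sum l) <= 2 ^ length l * wt l.
Proof.
  induction l as [|x l IH]; [simpl; lra|].
  assert (1 <= 2 ^ length l) by (apply pow_R1_Rle; lra).
  change (list_sum (x :: l)) with (x + list_sum l)%nat; rewrite plus_INR; simpl.
  pose proof (pos_INR x); nra.
Qed.

Lemma geom_weight_sum (p : R) (l : list nat) :
  geom_weight p l = p ^ length l * (1 - p) ^ list_sum l.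
Proof.
  induction l as [|x l IH]; [simpl; lra|].
  change (list_sum (x :: l)) with (x + list_sum l)%nat; rewrite pow_add; simpl.
  rewrite IH; ring.
Qed.

Lemma pow_le_anti (q : R) (m n : nat) : 0 <= q <= 1 -> (m <= n)%nat -> q ^ n <= q ^ m.
Proof.
  intros Hq Hmn; replace n with (m + (n - m))%nat by lia; rewrite pow_add.
  pose proof (pow_incr q 1 (n - m) Hq) as H; rewrite pow1 in H.
  pose proof (pow_le q m (proj1 Hq)); nra.
Qed.

(** A lattice point of the simplex carries at most [2^k] pebbles in all, so every such point has
    probability at least [p^k (1 - p)^(2^k)]. *)
Lemma simplex_prob_ge (K k : nat) (p t : R) :
  0 < p < 1 -> 0 <= t <= 1 -> 2 ^ k <= INR K ->
  p ^ k * (1 - p) ^ (2 ^ k) * (t ^ k * vol k) <= expect K p k (fun l => indic (wt l <= t)).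
Proof.
  intros Hp Ht HK; set (c := p ^ k * (1 - p) ^ (2 ^ k)).
  assert (0 < 2 ^ k) by (apply pow_lt; lra).
  assert (0 <= c) by (apply Rmult_le_pos; apply pow_le; lra).
  apply Rle_trans with (c * lsum (fun l => indic (wt l <= t)) (box K k)).
  - apply Rmult_le_compat_l, count_ge_vol; auto; try lra; nra.
  - rewrite <- lsum_scal; apply lsum_le; intros l Hl; apply in_box in Hl as [L _].
    destruct (classic (wt l <= t)) as [Hw|Hw];
      [rewrite indic_true by auto|rewrite indic_false by auto; lra].
    rewrite !Rmult_1_r, geom_weight_sum, L; unfold c.
    apply Rmult_le_compat_l; [apply pow_le; lra|apply pow_le_anti; [lra|]].
    apply INR_le; rewrite pow_INR; change (INR 2) with 2.
    pose proof (list_sum_wt l) as S; rewrite L in S; nra.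
Qed.

Lemma Forall_prob (K n Y : nat) (p : R) :
  0 < p < 1 -> (Y < K)%nat ->
  ((INR Y + 1) * (p * (1 - p) ^ Y)) ^ n <= expect K p n (fun l => indic (Forall (fun x => (x <= Y)%nat) l)).
Proof.
  intros Hp HY; set (g := (INR Y + 1) * (p * (1 - p) ^ Y)).
  assert (Hg : 0 <= p * (1 - p) ^ Y) by (apply Rmult_le_pos; [lra|apply pow_le; lra]).
  assert (Hg' : 0 <= g) by (pose proof (pos_INR Y); unfold g; nra).
  induction n as [|n IH].
  - rewrite expect_0, indic_true; auto; simpl; lra.
  - set (E := expect K p n (fun l => indic (Forall (fun x => (x <= Y)%nat) l))) in *.
    apply Rle_trans with (E * g).
    { rewrite <- tech_pow_Rmult, Rmult_comm; apply Rmult_le_compat_r; auto. }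
    assert (Es : seq 0 K = seq 0 (S Y) ++ seq (0 + S Y) (K - S Y))
      by (rewrite <- seq_app; f_equal; lia).
    rewrite expect_S, Es, lsum_app.
    assert (E0 : 0 <= E) by (apply expect_nonneg; auto; intros; apply indic_bounds).
    rewrite <- (Rplus_0_r (E * g)); apply Rplus_le_compat.
    + apply Rle_trans with (INR (length (seq 0 (S Y))) * (p * (1 - p) ^ Y * E)).
      * right; rewrite length_seq, S_INR; unfold g; ring.
      * apply lsum_ge_const; intros x Hx; apply in_seq in Hx.
        apply Rmult_le_compat; auto.
        -- apply Rmult_le_compat_l; [lra|apply pow_le_anti; [lra|lia]].
        -- apply expect_le; auto; intros l _ _; apply indic_mono; constructor; auto; lia.
    + apply lsum_nonneg; intros x _; apply Rmult_le_pos.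
      * apply Rmult_le_pos; [lra|apply pow_le; lra].
      * apply expect_nonneg; auto; intros; apply indic_bounds.
Qed.

(* The first [k] entries fill most of the simplex; the bound [Y] on the further ones and the cutoff on everything outside the block keep the rest of the weight below [1 / (k + 1)]. *)
Definition light_side (k Y : nat) (l : list nat) : Prop :=
  wt (firstn k l) <= INR k / (INR k + 1) /\ Forall (fun x => (x <= Y)%nat) (skipn k l).

Lemma wt_le_max (l : list nat) (M : nat) : Forall (fun x => (x <= M)%nat) l -> wt l <= INR M.
Proof.
  induction 1 as [|x l Hx H IH]; simpl; [apply pos_INR|]; apply le_INR in Hx; lra.
Qed.

(** The first [k] entries weigh at most [k / (k + 1)], the next [t] at most [1 / (2 (k + 1))], and
    the rest, whatever it is, strictly less than [1 / (2 (k + 1))]. *)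
Lemma light_side_wt (K k t Y : nat) (c r : list nat) :
  length c = (k + t)%nat -> light_side k Y c -> Forall (fun x => (x < K)%nat) r ->
  2 * (INR k + 1) * INR Y <= 2 ^ k -> 2 * (INR k + 1) * INR K < 2 ^ (k + t) ->
  wt (c ++ r) < 1.
Proof.
  intros L [H1 H2] H3 HY HK.
  rewrite <- (firstn_skipn k c), <- app_assoc, !wt_app.
  rewrite length_firstn, length_skipn, L.
  replace (Nat.min k (k + t)) with k by lia; replace (k + t - k)%nat with t by lia.
  apply wt_le_max in H2.
  assert (H4 : wt r <= INR K).
  { apply wt_le_max; eapply Forall_impl; [|exact H3]; intros; simpl in *; lia. }
  assert (Hk : 0 < INR k + 1) by (pose proof (pos_INR k); lra).
  assert (Hp : forall j, (1 / 2) ^ j = / 2 ^ j).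
  { intros; unfold Rdiv; rewrite Rmult_1_l, pow_inv; auto. }
  assert (A1 : (1 / 2) ^ k * wt (skipn k c) <= / (2 * (INR k + 1))).
  { rewrite Hp; pose proof (pow_lt 2 k ltac:(lra)).
    apply Rle_trans with (/ 2 ^ k * INR Y).
    - apply Rmult_le_compat_l; auto; left; apply Rinv_0_lt_compat; auto.
    - apply (Rmult_le_reg_l (2 ^ k * (2 * (INR k + 1)))); [apply Rmult_lt_0_compat; lra|].
      replace (2 ^ k * (2 * (INR k + 1)) * (/ 2 ^ k * INR Y)) with (2 * (INR k + 1) * INR Y) by (field; lra).
      replace (2 ^ k * (2 * (INR k + 1)) * / (2 * (INR k + 1))) with (2 ^ k) by (field; lra); auto. }
  assert (A2 : (1 / 2) ^ (k + t) * wt r < / (2 * (INR k + 1))).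
  { rewrite Hp; pose proof (pow_lt 2 (k + t) ltac:(lra)).
    apply Rle_lt_trans with (/ 2 ^ (k + t) * INR K).
    - apply Rmult_le_compat_l; auto; left; apply Rinv_0_lt_compat; auto.
    - apply (Rmult_lt_reg_l (2 ^ (k + t) * (2 * (INR k + 1)))); [apply Rmult_lt_0_compat; lra|].
      replace (2 ^ (k + t) * (2 * (INR k + 1)) * (/ 2 ^ (k + t) * INR K)) with (2 * (INR k + 1) * INR K) by (field; lra).
      replace (2 ^ (k + t) * (2 * (INR k + 1)) * / (2 * (INR k + 1))) with (2 ^ (k + t)) by (field; lra); auto. }
  rewrite pow_add in A2.
  assert (INR k / (INR k + 1) + 2 * / (2 * (INR k + 1)) = 1) by (field; lra).
  lra.
Qed.

Lemma light_side_prob (K k t Y : nat) (p : R) :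
  0 < p < 1 -> 2 ^ k <= INR K -> (Y < K)%nat ->
  p ^ k * (1 - p) ^ (2 ^ k) * ((INR k / (INR k + 1)) ^ k * vol k) *
    ((INR Y + 1) * (p * (1 - p) ^ Y)) ^ t <=
  expect K p (k + t) (fun l => indic (light_side k Y l)).
Proof.
  intros Hp HK HY.
  set (h1 := fun l => indic (wt l <= INR k / (INR k + 1))).
  set (h2 := fun l => indic (Forall (fun x => (x <= Y)%nat) l)).
  assert (Hk : 0 < INR k + 1) by (pose proof (pos_INR k); lra).
  assert (Hq : 0 <= INR k / (INR k + 1) <= 1).
  { split; [apply Rmult_le_pos; [apply pos_INR|left; apply Rinv_0_lt_compat; auto]|].
    apply (Rmult_le_reg_r (INR k + 1)); auto; unfold Rdiv.
    rewrite Rmult_assoc, Rinv_l by lra; lra. }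
  apply Rle_trans with (expect K p (k + t) (fun l => h1 (firstn k l) * h2 (skipn k l))).
  - rewrite expect_app; apply Rmult_le_compat.
    + pose proof (vol_pos k); repeat apply Rmult_le_pos; try apply pow_le; lra.
    + pose proof (pos_INR Y); apply pow_le; repeat apply Rmult_le_pos; try apply pow_le; lra.
    + apply simplex_prob_ge; auto.
    + apply Forall_prob; auto.
  - apply expect_le; auto; intros l _ _; unfold h1, h2, light_side, indic.
    destruct (excluded_middle_informative _), (excluded_middle_informative _),
      (excluded_middle_informative _); try tauto; lra.
Qed.

(** * Disjoint blocks of length [2 B + 1], each tested at its middle vertex *)

Fixpoint no_center (B : nat) (h : list nat -> R) (m : nat) (l : list nat) : R :=
  match m with
  | O => 1
  | S m' => (1 - center B h h (firstn (B + S B) l)) * no_center B h m' (skipn (B + S B) l)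
  end.

Lemma expect_no_center (K B m r : nat) (p : R) (h : list nat -> R) :
  (0 < K)%nat ->
  expect K p (m * (B + S B) + r) (no_center B h m) =
  (expect K p (B + S B) (fun _ => 1) - p * expect K p B h ^ 2) ^ m * expect K p r (fun _ => 1).
Proof.
  intros HK; induction m as [|m IH].
  - rewrite pow_O, Rmult_1_l; reflexivity.
  - replace (S m * (B + S B) + r)%nat with ((B + S B) + (m * (B + S B) + r))%nat by lia.
    cbn [no_center].
    set (h1 := fun l => 1 - center B h h l).
    change (expect K p (B + S B + (m * (B + S B) + r))
      (fun l => h1 (firstn (B + S B) l) * no_center B h m (skipn (B + S B) l)) =
      (expect K p (B + S B) (fun _ => 1) - p * expect K p B h ^ 2) ^ S m * expect K p r (fun _ => 1)).
    rewrite expect_app, IH; unfold h1.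
    rewrite (expect_minus K p (B + S B) (fun _ => 1) (center B h h)).
    rewrite expect_center by auto; simpl; ring.
Qed.

Lemma center_01 (B : nat) (P : list nat -> Prop) (l : list nat) :
  let h := fun l => indic (P l) in 0 <= center B h h l <= 1.
Proof.
  cbv zeta; unfold center, indic.
  destruct (excluded_middle_informative _), (excluded_middle_informative _),
      (excluded_middle_informative _); lra.
Qed.

Lemma no_center_nonneg (B : nat) (P : list nat -> Prop) (m : nat) (l : list nat) :
  0 <= no_center B (fun l => indic (P l)) m l.
Proof.
  revert l; induction m as [|m IH]; intros l; simpl; [lra|].
  apply Rmult_le_pos; auto; pose proof (center_01 B P (firstn (B + S B) l)); lra.
Qed.

Lemma center_bad (K B : nat) (P : list nat -> Prop) (pre c post : list nat) :
  (forall c r, length c = B -> P c -> Forall (fun x => (x < K)%nat) r -> wt (c ++ r) < 1) ->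
  length c = (B + S B)%nat -> Forall (fun x => (x < K)%nat) (pre ++ c ++ post) ->
  center B (fun l => indic (P l)) (fun l => indic (P l)) c <> 0 -> bad (pre ++ c ++ post).
Proof.
  intros Pwt L F Hc.
  apply Forall_app in F as [F1 F2]; apply Forall_app in F2 as [F2 F3].
  unfold center in Hc.
  destruct (classic (P (rev (firstn B c)))) as [H1|H1]; [|rewrite indic_false in Hc; auto; lra].
  destruct (classic (nth B c O = O)) as [H2|H2]; [|rewrite (indic_false (nth B c O = O)) in Hc; auto; lra].
  destruct (classic (P (skipn (S B) c))) as [H3|H3]; [|rewrite (indic_false (P (skipn (S B) c))) in Hc; auto; lra].
  exists (rev (firstn B c) ++ rev pre), (skipn (S B) c ++ post); split; [|split].
  - rewrite rev_app_distr, !rev_involutive, <- app_assoc; f_equal.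
    rewrite <- H2, app_comm_cons, <- skipn_nth by lia.
    rewrite app_assoc, firstn_skipn; auto.
  - apply Pwt; auto; [rewrite length_rev, length_firstn; lia|apply Forall_rev; auto].
  - apply Pwt; auto; rewrite length_skipn; lia.
Qed.

(** [pre] collects the blocks already passed, because [bad] refers to the whole list. *)
Lemma no_center_ge (K B : nat) (P : list nat -> Prop) (m : nat) (pre l : list nat) :
  (forall c r, length c = B -> P c -> Forall (fun x => (x < K)%nat) r -> wt (c ++ r) < 1) ->
  (m * (B + S B) <= length l)%nat -> Forall (fun x => (x < K)%nat) (pre ++ l) ->
  1 - indic (bad (pre ++ l)) <= no_center B (fun l => indic (P l)) m l.
Proof.
  intros Pwt; revert pre l; induction m as [|m IH]; intros pre l Hl F.
  - simpl; pose proof (indic_bounds (bad (pre ++ l))); lra.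
  - set (c := firstn (B + S B) l); set (post := skipn (B + S B) l).
    assert (El : l = c ++ post) by (symmetry; apply firstn_skipn).
    assert (Lc : length c = (B + S B)%nat) by (unfold c; rewrite length_firstn; simpl in Hl; lia).
    set (h := fun l => indic (P l)) in IH |- *; cbn [no_center]; fold c post.
    destruct (Req_dec (center B h h c) 0) as [E|E].
    + rewrite E, Rminus_0_r, Rmult_1_l.
      rewrite El, app_assoc; apply IH.
      * unfold post; rewrite length_skipn; simpl in Hl; lia.
      * rewrite <- app_assoc, <- El; auto.
    + rewrite indic_true.
      * pose proof (center_01 B P c) as C1; pose proof (no_center_nonneg B P m post) as C2.
        cbv zeta in C1; fold h in C1, C2; nra.
      * rewrite El; apply (center_bad K B P); auto; rewrite <- El; auto.
Qed.

Lemma unsolv_prob_ge_blocks (K B : nat) (P : list nat -> Prop) (n m : nat) (p : R) :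
  (forall c r, length c = B -> P c -> Forall (fun x => (x < K)%nat) r -> wt (c ++ r) < 1) ->
  0 < p < 1 -> (0 < K)%nat -> (m * (B + S B) <= n)%nat ->
  1 - INR n * (1 - p) ^ K - exp (- (INR m * (p * expect K p B (fun l => indic (P l)) ^ 2))) <= unsolv_prob n p.
Proof.
  intros Pwt Hp HK Hm; set (h := fun l => indic (P l)).
  apply Rle_trans with (expect K p n (fun l => indic (bad l))); [|apply expect_bad_le; auto].
  apply Rle_trans with (expect K p n (fun l => 1 - no_center B h m l)).
  - rewrite (expect_minus K p n (fun _ => 1) (no_center B h m)).
    pose proof (expect_one_ge K p n Hp).
    assert (expect K p n (no_center B h m) <= exp (- (INR m * (p * expect K p B h ^ 2)))); [|lra].
    replace n with (m * (B + S B) + (n - m * (B + S B)))%nat by lia.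
    rewrite expect_no_center by auto.
    set (Q := p * expect K p B h ^ 2).
    set (x := expect K p (B + S B) (fun _ => 1) - Q).
    (* [x] is the mass on which one block fails: an expectation of a nonnegative function, and at
       most [1 - Q] since the total mass is at most 1. *)
    assert (Hx : 0 <= x <= exp (- Q)).
    { split.
      - unfold x, Q.
        replace (p * expect K p B h ^ 2) with (expect K p (B + S B) (center B h h))
          by (rewrite expect_center by auto; simpl; ring).
        rewrite <- expect_minus; apply expect_nonneg; auto; intros l _ _.
        pose proof (center_01 B P l) as C1; cbv zeta in C1; fold h in C1; lra.
      - pose proof (expect_one_le K p (B + S B) Hp); pose proof (exp_ineq1_le (- Q)).
        unfold x; lra. }
    replace (exp (- (INR m * Q))) with (exp (- Q) ^ m * 1).
    + apply Rmult_le_compat; [apply pow_le; lra| |apply pow_incr; auto|apply expect_one_le; auto].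
      apply expect_nonneg; auto; intros; lra.
    + rewrite Rmult_1_r; clear; induction m as [|m IH].
      * simpl; rewrite Rmult_0_l, Ropp_0, exp_0; auto.
      * rewrite S_INR, <- tech_pow_Rmult, IH, <- exp_plus; f_equal; ring.
  - apply expect_le; auto; intros l L F.
    pose proof (no_center_ge K B P m [] l Pwt ltac:(lia) F) as C; fold h in C; simpl in C; lra.
Qed.

(** * Asymptotics *)

(** Since [vol k = 2^(k(k+1)/2) / k!], this is the weak Stirling bound
    [k! <= k^(k+1) exp (1 - k)]. *)
Lemma ln_vol_ge (k : nat) :
  (1 <= k)%nat ->
  INR k * (INR k + 1) / 2 * ln 2 - (INR k + 1) * ln (INR k) + INR k - 1 <= ln (vol k).
Proof.
  induction 1 as [|k Hk IH].
  - simpl; rewrite ln_1; replace (2 * 1 / 1 * 1) with 2 by field; lra.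
  - assert (Hk0 : 1 <= INR k) by (change 1 with (INR 1); apply le_INR; auto).
    cbn [vol]; rewrite ln_mult, ln_quot, ln_pow.
    + rewrite !S_INR.
      pose proof (ln_le_minus_1 (INR k / (INR k + 1)) ltac:(apply Rdiv_lt_0_compat; lra)) as H.
      rewrite ln_quot in H by lra.
      assert ((INR k + 1) * (INR k / (INR k + 1) - 1) = -1) by (field; lra).
      assert ((INR k + 1) * (ln (INR k) - ln (INR k + 1)) <= -1) by nra.
      lra.
    + lra.
    + apply pow_lt; lra.
    + apply lt_0_INR; lia.
    + apply Rdiv_lt_0_compat; [apply pow_lt; lra|apply lt_0_INR; lia].
    + apply vol_pos.
Qed.

Lemma exp_scal_nat (y : R) (m : nat) : exp y ^ m = exp (INR m * y).
Proof.
  induction m as [|m IH]; [simpl; rewrite Rmult_0_l, exp_0; auto|].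
  rewrite S_INR, <- tech_pow_Rmult, IH, <- exp_plus; f_equal; ring.
Qed.

(** With [1 - p = lam / (lam + 1)] this bounds powers of [1 - p] up to [lam]; with [x = k] it bounds
    the loss from shrinking the simplex to [k / (k + 1)]. *)
Lemma ratio_pow_ge (x : R) (m : nat) : 0 < x -> INR m <= x -> exp (-1) <= (x / (x + 1)) ^ m.
Proof.
  intros Hx Hm; apply Rle_trans with (exp (- / x) ^ m).
  - rewrite exp_scal_nat; apply exp_monotone.
    assert (INR m * / x <= 1); [|lra].
    apply (Rmult_le_reg_r x); auto; rewrite Rmult_assoc, Rinv_l by lra; lra.
  - apply pow_incr; split; [left; apply exp_pos|].
    rewrite exp_Ropp; replace (x / (x + 1)) with (/ (1 + / x)) by (field; lra).
    pose proof (Rinv_0_lt_compat x Hx); apply Rinv_le_contravar; [lra|apply exp_ineq1_le].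
Qed.

Lemma INR_le_pow2 (k : nat) : INR k <= 2 ^ k.
Proof.
  induction k as [|k IH]; [simpl; lra|].
  assert (1 <= 2 ^ k) by (apply pow_R1_Rle; lra); rewrite S_INR; simpl; lra.
Qed.

Lemma exp_m1_ge : / 3 <= exp (-1).
Proof.
  replace (-1) with (Ropp 1) by lra; rewrite exp_Ropp.
  pose proof exp_le_3; apply Rinv_le_contravar; [apply exp_pos|lra].
Qed.

Lemma exp_m4_le : exp (-4) <= / 5.
Proof.
  replace (-4) with (Ropp 4) by lra; rewrite exp_Ropp.
  pose proof (exp_ineq1_le 4); apply Rinv_le_contravar; lra.
Qed.

Lemma truncation_loss (n K : nat) (p : R) :
  0 < p < 1 -> (0 < n)%nat -> ln (INR n) + 4 <= p * INR K -> INR n * (1 - p) ^ K <= / 5.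
Proof.
  intros Hp Hn H; assert (0 < INR n) by (apply lt_0_INR; auto).
  apply Rle_trans with (exp (-4)); [|apply exp_m4_le].
  apply Rle_trans with (exp (ln (INR n)) * exp (- p) ^ K).
  - rewrite exp_ln by auto; apply Rmult_le_compat_l; [lra|].
    apply pow_incr; pose proof (exp_ineq1_le (- p)); lra.
  - rewrite exp_scal_nat, <- exp_plus; apply exp_monotone; lra.
Qed.

(** Truncation and the event that every block fails cost at most 1/5 each. The factor 5 in the last
    hypothesis gives 4 expected successes after rounding down the number of blocks, and
    [exp (-4) <= 1/5]. *)
Lemma unsolv_prob_gt_half (n K k t Y : nat) (p f : R) :
  0 < p < 1 -> (0 < n)%nat -> ln (INR n) + 4 <= p * INR K ->
  2 ^ k <= INR K -> (Y < K)%nat ->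
  2 * (INR k + 1) * INR Y <= 2 ^ k -> 2 * (INR k + 1) * INR K < 2 ^ (k + t) ->
  0 <= f -> f <= p ^ k * (1 - p) ^ (2 ^ k) * ((INR k / (INR k + 1)) ^ k * vol k) *
    ((INR Y + 1) * (p * (1 - p) ^ Y)) ^ t ->
  5 * (2 * (INR k + INR t) + 1) <= INR n * (p * f ^ 2) ->
  1 / 2 < unsolv_prob n p.
Proof.
  intros Hp Hn HnK HkK HYK HY HK Hf0 Hf HL.
  set (B := (k + t)%nat); set (L := (B + S B)%nat).
  assert (HK0 : (0 < K)%nat) by lia.
  pose proof (unsolv_prob_ge_blocks K B (light_side k Y) n (n / L) p) as G.
  specialize (G ltac:(intros c r Hc H1 H2; exact (light_side_wt K k t Y c r Hc H1 H2 HY HK)) Hp HK0).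
  pose proof (Nat.div_mod_eq n L) as D; pose proof (Nat.mod_upper_bound n L ltac:(lia)) as D'.
  specialize (G ltac:(fold L; lia)).
  pose proof (light_side_prob K k t Y p Hp HkK HYK) as F; fold B in F.
  set (E := expect K p B (fun l => indic (light_side k Y l))) in *.
  assert (E1 : E <= 1) by (apply expect_le_1; auto; intros; apply indic_bounds).
  assert (HfE : f <= E) by lra.
  pose proof (truncation_loss n K p Hp Hn HnK) as T.
  assert (HLR : INR L = 2 * (INR k + INR t) + 1).
  { unfold L, B; rewrite plus_INR, S_INR, plus_INR; ring. }
  assert (HP : p * f ^ 2 <= p * E ^ 2 <= 1).
  { split.
    - apply Rmult_le_compat_l; [lra|apply pow_incr; auto].
    - assert (E ^ 2 <= 1) by (simpl; nra); nra. }
  assert (Hm : 4 <= INR (n / L) * (p * E ^ 2)).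
  { assert (HnL : INR n <= INR L * (INR (n / L) + 1)).
    { rewrite <- S_INR, <- mult_INR; apply le_INR; nia. }
    assert (HL1 : 1 <= INR L) by (pose proof (pos_INR k); pose proof (pos_INR t); lra).
    assert (0 <= p * E ^ 2) by (apply Rmult_le_pos; [lra|apply pow_le; lra]).
    assert (H5 : 5 * INR L <= INR L * (INR (n / L) + 1) * (p * E ^ 2)).
    { rewrite HLR at 1; eapply Rle_trans; [exact HL|].
      apply Rmult_le_compat; try lra; [apply pos_INR|].
      apply Rmult_le_pos; [lra|apply pow_le; lra]. }
    assert (5 <= (INR (n / L) + 1) * (p * E ^ 2)).
    { apply (Rmult_le_reg_l (INR L)); lra. }
    lra. }
  assert (exp (- (INR (n / L) * (p * E ^ 2))) <= / 5).
  { eapply Rle_trans; [apply exp_monotone|apply exp_m4_le]; lra. }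
  lra.
Qed.

Lemma ln_sqr_le (s : R) : 1 <= s -> ln s * ln s <= 16 * sqrt s.
Proof.
  intros Hs; assert (Hu := sqrt_lt_R0 s ltac:(lra)).
  pose proof (ln_le_sqrt (sqrt s) Hu) as H.
  assert (E : ln s = 2 * ln (sqrt s)).
  { rewrite <- (sqrt_sqrt s) at 1 by lra; rewrite ln_mult by auto; ring. }
  assert (0 <= ln s).
  { rewrite <- ln_1; destruct (Rle_lt_or_eq_dec 1 s Hs) as [H1| <-]; [left; apply ln_increasing|]; lra. }
  pose proof (sqrt_sqrt (sqrt s) ltac:(lra)); pose proof (sqrt_pos (sqrt s)).
  nra.
Qed.

(* [k = floor (s - log2 s)] keeps [2^k <= lam], so that the geometric weights on the simplex are constant up to a factor [e]; the [t] further entries, with [2^t] of order [s^3], cost only [exp (O (ln s ^ 2))]. *)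
Lemma unsolv_prob_lower (n : nat) (lam s : R) :
  2000000 <= s -> (0 < n)%nat -> ln (INR n) = s * s * ln 2 -> 0 < lam ->
  s * ln 2 - ln s <= ln lam -> ln lam <= s * ln 2 - ln s + 1 - 600 / sqrt s ->
  1 / 2 < unsolv_prob n (/ (1 + lam)).
Proof.
  intros Hs Hn0 Hn Hlam Hl1 Hl2; pose proof ln2_bounds as L2.
  assert (Hu : 1000 <= sqrt s).
  { rewrite <- (sqrt_Rsqr 1000) by lra; apply sqrt_le_1; unfold Rsqr; lra. }
  assert (Huu := sqrt_sqrt s ltac:(lra)); set (u := sqrt s) in *.
  assert (Hls1 := ln_le_sqrt s ltac:(lra)); fold u in Hls1.
  assert (Hls2 := ln_sqr_le s ltac:(lra)); fold u in Hls2.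
  assert (Hls0 : 10 <= ln s).
  { apply Rle_trans with (ln (2 ^ 20)).
    - rewrite ln_pow by lra; replace (INR 20) with 20 by (simpl; lra); lra.
    - left; apply ln_increasing; [apply pow_lt|]; lra. }
  set (ls := ln s) in *.
  assert (Hsu : 1000 * u <= s) by nra.
  destruct (nat_floor ((s * ln 2 - ls) / ln 2)) as (k & Hk1 & Hk2).
  { apply Rmult_le_pos; [nra|left; apply Rinv_0_lt_compat; lra]. }
  apply (Rmult_le_compat_r (ln 2)) in Hk1; [|lra].
  apply (Rmult_lt_compat_r (ln 2)) in Hk2; [|lra].
  unfold Rdiv in Hk1, Hk2; rewrite Rmult_assoc, Rinv_l, Rmult_1_r in Hk1, Hk2 by lra.
  assert (Hks : INR k + 1 <= s) by nra.
  assert (Hks' : s <= 2 * INR k + 1) by nra.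
  assert (Hk0 : (1 <= k)%nat) by (apply INR_le; simpl; lra).
  set (Q := 2 ^ k).
  assert (HQ0 : 0 < Q) by (apply pow_lt; lra).
  assert (HQk := INR_le_pow2 k); fold Q in HQk.
  assert (LQ : ln Q = INR k * ln 2) by (apply ln_pow; lra).
  assert (HQ1 : Q <= lam).
  { rewrite <- (exp_ln Q), <- (exp_ln lam) by auto; apply exp_monotone; lra. }
  assert (Heta : 0 < 600 / u) by (apply Rdiv_lt_0_compat; lra).
  assert (HQ2 : lam <= 6 * Q).
  { rewrite <- (exp_ln lam) by auto.
    apply Rle_trans with (exp (ln Q + ln 2 + 1)); [apply exp_monotone; lra|].
    rewrite !exp_plus, !exp_ln by lra; pose proof exp_le_3; nra. }
  pose proof (prob_param_bounds lam Hlam) as Hp; set (p := / (1 + lam)) in *.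
  assert (Eq : 1 - p = lam / (lam + 1)) by (unfold p; field; lra).
  assert (Ep1 : p * (1 + lam) = 1) by (unfold p; field; lra).
  assert (Ep2 : / (2 * lam) <= p) by (apply Rinv_le_contravar; lra).
  assert (Elp : - ln lam - / lam <= ln p).
  { unfold p; rewrite ln_Rinv by lra.
    replace (1 + lam) with (lam * (1 + / lam)) by (field; lra).
    pose proof (Rinv_0_lt_compat lam Hlam); rewrite ln_mult by lra.
    pose proof (ln_le_minus_1 (1 + / lam)); lra. }
  (* As [p (1 + lam) = 1], this cutoff makes [p K >= s^2 + 4 >= ln n + 4]. *)
  destruct (nat_floor ((1 + lam) * (s * s + 4))) as (K' & HK1 & HK2); [nra|].
  set (K := S K').
  assert (HKR : INR K = INR K' + 1) by apply S_INR.
  destruct (nat_floor (Q / (2 * (INR k + 1)))) as (Y & HY1 & HY2).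
  { left; apply Rdiv_lt_0_compat; lra. }
  assert (HYQ : 2 * (INR k + 1) * INR Y <= Q).
  { apply (Rmult_le_compat_l (2 * (INR k + 1))) in HY1; [|lra].
    replace (2 * (INR k + 1) * (Q / (2 * (INR k + 1)))) with Q in HY1 by (field; lra); auto. }
  assert (HYQ' : Q <= 2 * (INR k + 1) * (INR Y + 1)).
  { apply (Rmult_lt_compat_l (2 * (INR k + 1))) in HY2; [|lra].
    replace (2 * (INR k + 1) * (Q / (2 * (INR k + 1)))) with Q in HY2 by (field; lra); lra. }
  assert (HYlam : INR Y <= lam) by (pose proof (pos_INR Y); nra).
  assert (HlK : lam < INR K) by nra.
  (* Chosen to make [2^t > 48 s^3]: the far entries require [2 (k + 1) K < 2^k 2^t], and the left
     side is at most [2 s * 4 (6 Q) s^2]. *)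
  destruct (nat_floor ((ln 48 + 3 * ls) / ln 2)) as (t' & Ht1 & Ht2).
  { apply Rmult_le_pos; [|left; apply Rinv_0_lt_compat; lra].
    pose proof (ln_increasing 1 48); rewrite ln_1 in *; lra. }
  apply (Rmult_le_compat_r (ln 2)) in Ht1; [|lra].
  apply (Rmult_lt_compat_r (ln 2)) in Ht2; [|lra].
  unfold Rdiv in Ht1, Ht2; rewrite Rmult_assoc, Rinv_l, Rmult_1_r in Ht1, Ht2 by lra.
  set (t := S t').
  assert (HtR : INR t = INR t' + 1) by apply S_INR.
  assert (H48 : ln 48 < ls) by (apply ln_increasing; lra).
  assert (Ht9 : INR t <= 9 * ls).
  { assert (INR t' * (1 / 2) <= INR t' * ln 2)
      by (apply Rmult_le_compat_l; [apply pos_INR|lra]); lra. }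
  assert (Ht2' : 48 * (s * s * s) < 2 ^ t).
  { assert (0 < s * s) by (apply Rmult_lt_0_compat; lra).
    assert (0 < s * s * s) by (apply Rmult_lt_0_compat; lra).
    assert (0 < 2 ^ t) by (apply pow_lt; lra).
    apply ln_lt_inv; [lra|auto|].
    rewrite ln_pow by lra; rewrite !ln_mult by lra; fold ls; rewrite HtR; lra. }
  set (G := (INR Y + 1) * (p * (1 - p) ^ Y)).
  (* An entry is at most [Y] with probability at least [1 / (72 s)], because [Y + 1] is at least
     [lam / (12 s)]; this is weakened to [1 / s^2]. *)
  assert (HG : exp (- (2 * ls)) <= G).
  { assert (E1 : exp (- (2 * ls)) = / (s * s)).
    { rewrite exp_Ropp; replace (2 * ls) with (ls + ls) by ring; rewrite exp_plus.
      unfold ls; rewrite exp_ln by lra; auto. }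
    pose proof (ratio_pow_ge lam Y Hlam HYlam) as R; rewrite <- Eq in R.
    pose proof exp_m1_ge.
    apply Rle_trans with (Q / (2 * (INR k + 1)) * (/ (2 * lam) * / 3)).
    - rewrite E1.
      apply Rle_trans with (/ (72 * s)); [apply Rinv_le_contravar; [lra|apply Rmult_le_compat_r; lra]|].
      apply Rle_trans with (Q / (2 * s) * (/ (2 * (6 * Q)) * / 3)).
      + right; field; lra.
      + apply Rmult_le_compat.
        * left; apply Rdiv_lt_0_compat; lra.
        * left; apply Rmult_lt_0_compat; [apply Rinv_0_lt_compat|]; lra.
        * apply Rmult_le_compat_l; [lra|apply Rinv_le_contravar; lra].
        * apply Rmult_le_compat_r; [lra|apply Rinv_le_contravar; lra].
    - assert (0 < / (2 * lam)) by (apply Rinv_0_lt_compat; lra).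
      assert (0 < Q / (2 * (INR k + 1))) by (apply Rdiv_lt_0_compat; lra).
      assert (Q / (2 * (INR k + 1)) <= INR Y + 1) by lra.
      unfold G; apply Rmult_le_compat; [lra|lra|auto|].
      apply Rmult_le_compat; lra. }
  assert (Hvol := ln_vol_ge k Hk0); assert (Hvp := vol_pos k).
  assert (HkR : 1 <= INR k) by (change 1 with (INR 1); apply le_INR; auto).
  assert (Hs2 : 10 * 10 <= s * s) by (apply Rmult_le_compat; lra).
  (* Logarithm of the lower bound for a light side: the [-2] pays for two factors [1 / e], the last
     term for the [t] far entries. *)
  set (X := INR k * ln p - 2 + ln (vol k) - INR t * (2 * ls)).
  apply (unsolv_prob_gt_half n K k t Y p (exp X)); auto.
  - rewrite Hn, HKR.
    apply Rle_trans with (p * ((1 + lam) * (s * s + 4))); [|apply Rmult_le_compat_l; lra].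
    rewrite <- Rmult_assoc, Ep1.
    assert (s * s * ln 2 <= s * s * 1) by (apply Rmult_le_compat_l; lra); lra.
  - fold Q; lra.
  - apply INR_lt; lra.
  - rewrite pow_add; fold Q.
    assert (A : (1 + lam) * (s * s + 4) <= 2 * lam * (3 / 2 * (s * s)))
      by (apply Rmult_le_compat; lra).
    assert (A' : 1 * 1 <= lam * (s * s)) by (apply Rmult_le_compat; lra).
    assert (A2 : lam * (s * s) <= 6 * Q * (s * s)) by (apply Rmult_le_compat_r; lra).
    assert (0 <= INR K) by apply pos_INR.
    apply Rle_lt_trans with (2 * s * (4 * (6 * Q) * (s * s))).
    + apply Rmult_le_compat; lra.
    + replace (2 * s * (4 * (6 * Q) * (s * s))) with (Q * (48 * (s * s * s))) by ring.
      apply Rmult_lt_compat_l; auto.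
  - left; apply exp_pos.
  - fold G.
    replace X with (INR k * ln p + -1 + (-1 + ln (vol k)) + INR t * (- (2 * ls))) by (unfold X; ring).
    rewrite !exp_plus, (exp_ln (vol k)) by auto.
    rewrite <- !exp_scal_nat, exp_ln by lra.
    pose proof (exp_pos (-1)).
    assert (0 < p ^ k) by (apply pow_lt; lra).
    pose proof (pow_le (exp (- (2 * ls))) t (Rlt_le _ _ (exp_pos _))).
    assert (0 <= p ^ k * exp (-1)) by (apply Rmult_le_pos; lra).
    assert (0 <= exp (-1) * vol k) by (apply Rmult_le_pos; lra).
    apply Rmult_le_compat; auto.
    + apply Rmult_le_pos; auto.
    + apply Rmult_le_compat; auto.
      * apply Rmult_le_compat_l; [lra|]; rewrite Eq; apply ratio_pow_ge; auto.
        rewrite pow_INR; exact HQ1.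
      * apply Rmult_le_compat_r; [lra|]; apply ratio_pow_ge; lra.
    + apply pow_incr; split; auto; left; apply exp_pos.
  - apply Rle_trans with (s * s).
    { assert (15 * s <= s * s) by (apply Rmult_le_compat_r; lra); lra. }
    replace (INR n * (p * exp X ^ 2)) with (exp (ln (INR n) + ln p + 2 * X)).
    2:{ replace (2 * X) with (X + X) by ring; rewrite !exp_plus, !exp_ln by (try lra; apply lt_0_INR; auto).
        simpl; ring. }
    apply Rle_trans with (exp (ls + ls)).
    { rewrite exp_plus; unfold ls; rewrite exp_ln by lra; lra. }
    apply exp_monotone; unfold X; rewrite Hn.
    assert (A1 : (2 * INR k + 1) * / lam <= 3).
    { apply (Rmult_le_reg_r lam); auto; rewrite Rmult_assoc, Rinv_l by lra; lra. }
    assert (A2 : (2 * INR k + 1) * (- ln lam - / lam) <= (2 * INR k + 1) * ln p)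
      by (apply Rmult_le_compat_l; lra).
    assert (A3 : (2 * INR k + 1) * ln lam <= (2 * INR k + 1) * (s * ln 2 - ls + 1 - 600 / u))
      by (apply Rmult_le_compat_l; lra).
    (* Origin of 600: the far entries cost [4 t ln s <= 36 (ln s)^2 <= 576 sqrt s], and the
       remaining [24 sqrt s] covers the other lower-order terms. *)
    assert (A4 : 600 * u <= (2 * INR k + 1) * (600 / u)).
    { apply Rle_trans with (s * (600 / u)); [|apply Rmult_le_compat_r; lra].
      rewrite <- Huu; right; field; lra. }
    assert (A5 : INR t * ls <= 9 * ls * ls) by (apply Rmult_le_compat_r; lra).
    assert (A6 : ln (INR k) <= ls).
    { left; apply ln_increasing; lra. }
    assert (A7 : (INR k + 1) * ln (INR k) <= (INR k + 1) * ls) by (apply Rmult_le_compat_l; lra).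
    (* The same quadratic term as in the upper bound, now nonnegative because [k + 1 <= s]. *)
    assert (A8 : 0 <= (s - INR k) * (s - INR k - 1) * ln 2)
      by (repeat apply Rmult_le_pos; lra).
    lra.
Qed.

Theorem theorem16 :
  exists (C : R) (N : nat), 0 < C /\
    forall n : nat, (N <= n)%nat ->
      (exists T, is_geom_threshold n T) /\
      (forall T, is_geom_threshold n T ->
         exists r, T = main_term n * (1 + r) /\
                   Rabs r <= C / Rpower (ln (INR n)) (1 / 4)).
Proof.
  set (s0 := 2000000).
  destruct (nat_floor (exp (s0 * s0))) as (N & _ & HN); [left; apply exp_pos|].
  exists 600, (S N); split; [lra|]; intros n Hn.
  pose proof ln2_bounds as L2.
  assert (Hn0 : (0 < n)%nat) by lia.
  assert (HnR : 0 < INR n) by (apply lt_0_INR; auto).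
  assert (Hln : s0 * s0 <= ln (INR n)).
  { rewrite <- (ln_exp (s0 * s0)); left; apply ln_increasing; [apply exp_pos|].
    apply le_INR in Hn; rewrite S_INR in Hn; lra. }
  assert (Hs0 : s0 = 2000000) by reflexivity; clearbody s0.
  set (x := ln (INR n)) in *.
  assert (Hx : 0 < x) by nra.
  assert (Hlog : x <= log2 (INR n)).
  { unfold log2; fold x; apply (Rmult_le_reg_r (ln 2)); [lra|].
    unfold Rdiv; rewrite Rmult_assoc, Rinv_l by lra; nra. }
  set (s := sqrt (log2 (INR n))).
  assert (Hs : s0 <= s).
  { unfold s; rewrite <- (sqrt_Rsqr s0) by lra; apply sqrt_le_1; unfold Rsqr; nra. }
  assert (Hss : x = s * s * ln 2).
  { unfold s; rewrite sqrt_sqrt by lra; unfold log2; fold x; field; lra. }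
  assert (Hu : 1400 <= sqrt s).
  { rewrite <- (sqrt_Rsqr 1400) by lra; apply sqrt_le_1; unfold Rsqr; lra. }
  set (y := 600 / sqrt s).
  assert (Hy : 0 < y <= 1 / 2).
  { unfold y; split; [apply Rdiv_lt_0_compat; lra|].
    apply (Rmult_le_reg_r (sqrt s)); [lra|].
    unfold Rdiv; rewrite Rmult_assoc, Rinv_l by lra; lra. }
  set (mu := exp 1 * Rpower 2 s / s).
  assert (Hmu0 : 0 < mu).
  { unfold mu, Rpower; apply Rdiv_lt_0_compat; [|lra].
    apply Rmult_lt_0_compat; apply exp_pos. }
  assert (Hmu : ln mu = s * ln 2 - ln s + 1).
  { unfold mu, Rpower; pose proof (exp_pos 1); pose proof (exp_pos (s * ln 2)).
    rewrite ln_quot, ln_mult, !ln_exp; try lra; apply Rmult_lt_0_compat; auto. }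
  assert (Hmain : main_term n = mu * INR n) by reflexivity.
  destruct (threshold_bracket n (mu * (1 - y)) (mu * (1 + y))) as [Ex Br]; auto.
  - apply Rmult_lt_0_compat; lra.
  - apply Rmult_lt_compat_l; lra.
  - pose proof (ln_le_minus_1 (1 - y) ltac:(lra)).
    pose proof (ln_le_minus_1 (/ (1 - y)) ltac:(apply Rinv_0_lt_compat; lra)) as H1.
    rewrite ln_Rinv in H1 by lra.
    assert (/ (1 - y) <= 2).
    { replace 2 with (/ (/ 2)) by field; apply Rinv_le_contravar; lra. }
    apply (unsolv_prob_lower n _ s); auto; try lra; [apply Rmult_lt_0_compat; lra| |];
      rewrite ln_mult, Hmu by lra; fold y; lra.
  - pose proof (ln_le_minus_1 (/ (1 + y)) ltac:(apply Rinv_0_lt_compat; lra)) as H1.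
    rewrite ln_Rinv in H1 by lra.
    (* Yields [ln (1 + y) >= y / 2], far more than the [y / 30] that equals the margin
       [20 / sqrt s]. *)
    assert (/ (1 + y) <= 1 - y / 2).
    { apply (Rmult_le_reg_r (1 + y)); [lra|]; rewrite Rinv_l by lra; nra. }
    apply (unsolv_prob_upper n _ s); auto; try lra; [apply Rmult_lt_0_compat; lra|].
    rewrite ln_mult, Hmu by lra.
    replace (20 / sqrt s) with (y / 30) by (unfold y; field; lra); lra.
  - split; auto; intros T HT; destruct (Br T HT) as [B1 B2].
    exists (T / INR n / mu - 1); split.
    + rewrite Hmain; field; lra.
    + assert (E : T / INR n = mu * (T / INR n / mu)) by (field; lra).
      rewrite E in B1, B2.
      apply Rmult_lt_reg_l in B1; auto; apply Rmult_lt_reg_l in B2; auto.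
      apply Rle_trans with y; [apply Rabs_le; lra|].
      unfold y; apply Rmult_le_compat_l; [lra|].
      apply Rinv_le_contravar; [apply exp_pos|].
      (* From [x = s^2 ln 2 <= s^2], the fourth root of [ln n] is at most [sqrt s]. *)
      replace (Rpower x (1 / 4)) with (sqrt (sqrt x)).
      * apply sqrt_le_1; [apply sqrt_pos|lra|]; apply sqrt_le_1; lra.
      * rewrite <- (Rpower_sqrt (sqrt x)) by (apply sqrt_lt_R0; auto).
        rewrite <- (Rpower_sqrt x), Rpower_mult by auto; f_equal; field.
Qed.
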